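(* There exist positive constants $K_1$ and $K_2$ depending only on $\mu$ and $\lambda$ such that for all $N\ge2$ and $T\ge1$, $$\inf_{(\widehat{\mathcal P}_+,\widehat{\mathcal P}_-)}\ \max_{S\in\mathcal S}\ \mathbb E_S\big[\mathrm{MR}(\widehat{\mathcal P}_+,\widehat{\mathcal P}_-)\big]\ \ge\ \frac{r_{\min}-N^{-1}}{2}\left(1-\tau_{K_1}\Big(\frac TN\Big)-2\tau_{K_2}\Big(\frac{\log(2N)}{N}\Big)\right),$$ where $r_{\min}=r_+\wedge r_-$, $\mathcal S=\{S\subset[N]:|S|=\lceil Nr_+\rceil\}$ and the infimum is over all random partitions $(\widehat{\mathcal P}_+,\widehat{\mathcal P}_-)$ of $[N]$ which are measurable with respect to $\sigma(X_1,\dots,X_{T+1})$.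
   Context: Model. Fix $0<\lambda<1$, $0<\mu\le\lambda$, $0<p\le1$ and $r_+,r_-\in(0,1)$ with $r_++r_-=1$; $[N]=\{1,\dots,N\}$. For $S\in\mathcal S$, $\mathbb P_S$ (with expectation $\mathbb E_S$) is the probability measure under which $\theta=(\theta_{ij})_{i,j\in[N]}$ is i.i.d. $\mathrm{Ber}(p)$ and, conditionally on $\theta$, $X=(X_t)_{t\in\mathbb Z}$ is the (unique in law) stationary Markov chain on $\{0,1\}^N$ such that, given $X_{t-1}=x$, the coordinates of $X_t$ are independent with $X_{i,t}\sim\mathrm{Ber}(p_{\theta,S,i}(x))$, where $$p_{\theta,S,i}(x)=\mu+\frac{1-\lambda}{N}\Big(\sum_{j\in S}\theta_{ij}x_j+\sum_{j\in S^c}\theta_{ij}(1-x_j)\Big).$$ That is, the true communities under $\mathbb P_S$ are $(\mathcal P_+,\mathcal P_-)=(S,S^c)$ with $S^c=[N]\setminus S$. Misclassification rate (with respect to the true communities): $\mathrm{MR}(\widehat{\mathcal P}_+,\widehat{\mathcal P}_-)=N^{-1}\big(|\widehat{\mathcal P}_+\cap\mathcal P_-|+|\widehat{\mathcal P}_-\cap\mathcal P_+|\big)$. For $K>0$, $u\ge0$: $\tau_K(u)=\sqrt{1-\exp(-Ku)}$.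
   Formalization: The bound is proved when r_min ≥ 1/N or the bracket 1−τ_{K1}−2τ_{K2} is ≥ 0; when both factors are negative the claim as stated fails (N=2, r_+=9/10, T large: the risk is 0 but the right side is positive). *)

(* Defs.v *)
From HB Require Import structures.
From mathcomp Require Import all_boot all_order all_algebra.
From mathcomp Require Import all_classical all_reals all_analysis.
Set Implicit Arguments.
Unset Strict Implicit.
Unset Printing Implicit Defensive.
Import Order.TTheory GRing.Theory Num.Theory.
Import numFieldNormedType.Exports.
Local Open Scope classical_set_scope.
Local Open Scope ring_scope.

Section Conditioning.
Context {d : measure_display} {Omega : measurableType d} {R : realType}.

(* P(A | B); only used below for P(B) > 0. *)
Definition cprob (P : probability Omega R) (B A : set Omega) : R :=
  fine (P (A `&` B)) / fine (P B).

(* Under Q the (B i)_{i in I} are independent with B i ~ Ber(q i): the product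
   rule over every subfamily J, the case J = {i} giving the marginals. *)
Definition indep_bernoulli (Q : set Omega -> R) (I : finType)
    (B : I -> Omega -> bool) (q : I -> R) : Prop :=
  forall (J : {set I}) (b : I -> bool),
    Q [set w | forall i, i \in J -> B i w = b i]
    = \prod_(i in J) bernoulli_pmf (q i) (b i).

End Conditioning.

Section Model.
Context {R : realType} {N : nat}.

(* p_{theta,S,i}(x) *)
Definition rate (mu lambda : R) (theta : 'I_N -> 'I_N -> bool)
    (S : {set 'I_N}) (i : 'I_N) (x : 'I_N -> bool) : R :=
  mu + (1 - lambda) / N%:R *
    (\sum_(j in S) (theta i j)%:R * (x j)%:R
     + \sum_(j in ~: S) (theta i j)%:R * (1 - (x j)%:R)).

Context {d : measure_display} {Omega : measurableType d}.
Implicit Types (theta : 'I_N -> 'I_N -> {mfun Omega >-> bool})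
  (X : int -> 'I_N -> {mfun Omega >-> bool}).

Definition theta_is theta (a : 'I_N -> 'I_N -> bool) : set Omega :=
  [set w | forall i j, theta i j w = a i j].

Definition X_is X (t : int) (x : 'I_N -> bool) : set Omega :=
  [set w | forall i, X t i w = x i].

(* Given theta = a, X is a Markov chain whose transition from x makes the
   coordinates independent with parameters rate ... i x.  The past is
   conditioned on through its cylinders: X_{t-1-k} = x k for k <= n. *)
Definition markov_given (P : probability Omega R) (mu lambda : R)
    (S : {set 'I_N}) theta X (a : 'I_N -> 'I_N -> bool) : Prop :=
  forall (t : int) (n : nat) (x : nat -> 'I_N -> bool),
    let past := theta_is theta a `&`
      [set w | forall k : nat, (k <= n)%N -> X_is X (t - 1 - k%:Z) (x k) w] in
    (0 < P past)%E ->
    indep_bernoulli (cprob P past) (fun i => X t i : Omega -> bool)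
      (fun i => rate mu lambda a S i (x 0%N)).

(* Given theta = a, X is stationary: the laws of (X_t, ..., X_{t+n-1}) and
   (X_{t+h}, ..., X_{t+h+n-1}) agree. *)
Definition stationary_given (P : probability Omega R)
    theta X (a : 'I_N -> 'I_N -> bool) : Prop :=
  forall (t h : int) (n : nat) (x : nat -> 'I_N -> bool),
    cprob P (theta_is theta a)
      [set w | forall k : nat, (k < n)%N -> X_is X (t + h + k%:Z) (x k) w]
    = cprob P (theta_is theta a)
        [set w | forall k : nat, (k < n)%N -> X_is X (t + k%:Z) (x k) w].

(* P is a version of P_S, with (theta, X) realised on Omega. *)
Definition is_model (P : probability Omega R) (mu lambda p : R)
    (S : {set 'I_N}) theta X : Prop :=
  [/\ indep_bernoulli (fun A => fine (P A))
        (fun ij : 'I_N * 'I_N => theta ij.1 ij.2 : Omega -> bool) (fun=> p),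
      forall a, (0 < P (theta_is theta a))%E ->
        markov_given P mu lambda S theta X a
    & forall a, (0 < P (theta_is theta a))%E ->
        stationary_given P theta X a].

(* sigma(X_1, ..., X_{T+1}) *)
Definition sigma_obs X (T : nat) : set (set Omega) :=
  <<s [set A | exists (t : nat) (i : 'I_N) (B : set bool),
         (1 <= t <= T.+1)%N /\ A = X t%:Z i @^-1` B] >>.

(* Ordered partitions of [N], either part possibly empty. *)
Definition is_estimator X (T : nat)
    (Phat : Omega -> {set 'I_N} * {set 'I_N}) : Prop :=
  (forall w, (Phat w).2 = ~: (Phat w).1) /\
  (forall D : set ({set 'I_N} * {set 'I_N}), sigma_obs X T (Phat @^-1` D)).

(* Misclassification rate of hat with respect to the true communities. *)
Definition MR (com hat : {set 'I_N} * {set 'I_N}) : R :=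
  N%:R^-1 * (#|hat.1 :&: com.2| + #|hat.2 :&: com.1|)%:R.

Definition calS (rplus : R) (S : {set 'I_N}) : bool :=
  #|S|%:Z == Num.ceil (N%:R * rplus).

Definition max_risk (P : {set 'I_N} -> probability Omega R) (rplus : R)
    (Phat : Omega -> {set 'I_N} * {set 'I_N}) : \bar R :=
  \big[maxe/-oo%E]_(S : {set 'I_N} | calS rplus S)
    'E_(P S)[fun w => MR (S, ~: S) (Phat w)]%E.

End Model.

Definition tau {R : realType} (K u : R) : R := Num.sqrt (1 - expR (- (K * u))).

(* Main.v *)
(** Moving one label between [S = U :\ k] and [S' = U :\ l] turns one correct
    label into a wrong one, so averaging over the pairs [k <> l] of [U] and over
    [U] reduces the bound to testing [P_S] against [P_S'] from the path
    [X_1, ..., X_{T+1}]. Given [theta], the state at time [- m], with [m] of order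
    [ln (2N)], is replaced by a fixed one, the kernel being a
    [(1 - lambda)]-contraction for the Hamming distance.

    When [mu = lambda] the rates may reach [1], the Kullback-Leibler divergence of
    the two kernels may be infinite, and one works with the Hellinger affinity.
    Writing the geometric mean of the kernels as a Markov kernel [M] times a loss
    factor [exp (- h)], Jensen's inequality bounds the affinity of [n] steps below
    by [exp (- sum_t E_M h(X_t))], and one needs [M h] to be [O(1 / N)]. Now
    [h(x)] is at most [(C / N) sum_i 1{rates differ at i} / (1 + D_i(x))], where
    [D_i] counts the neighbours of [i] that do not push it up. If [S^c] is large,
    then [D_i] is of order [N] because the rates are at least [mu]. If [S] is
    large, the rates differ only if [theta_ik], [theta_il], [x_k] or [x_l] is [0];
    on average over the pairs [(k, l)] of [U] each of these failures is one among
    the [D_i], which makes the sum [O(1)]. *)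
Require Import Defs.
From HB Require Import structures.
From mathcomp Require Import all_boot all_order all_algebra.
From mathcomp Require Import all_classical all_reals all_analysis.
From mathcomp Require Import measurable_realfun.
From mathcomp Require Import ring lra.
Set Implicit Arguments.
Unset Strict Implicit.
Unset Printing Implicit Defensive.
Import Order.TTheory GRing.Theory Num.Theory.
Import numFieldNormedType.Exports.
Local Open Scope classical_set_scope.
Local Open Scope ring_scope.

(** * Products of Bernoulli laws *)

Section ProductBernoulli.
Context {R : realType} {I : finType}.
Implicit Types (q r : I -> R) (x y z : {ffun I -> bool}).

Definition bern q y : R := \prod_i bernoulli_pmf (q i) (y i).

Definition is_rate q := forall i, 0 <= q i <= 1.

Definition hamming x y : R := \sum_i (x i != y i)%:R.

Lemma bern_ge0 q y : is_rate q -> 0 <= bern q y.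
Proof. by move=> qr; apply: prodr_ge0 => i _; exact: bernoulli_pmf_ge0. Qed.

Lemma sum_prod_ffun (F : I -> bool -> R) :
  \sum_(y : {ffun I -> bool}) \prod_i F i (y i) = \prod_i (F i true + F i false).
Proof.
rewrite -(bigA_distr_bigA (fun i b => F i b)).
by apply: eq_bigr => i _; rewrite big_bool.
Qed.

Lemma sum_bern q : \sum_y bern q y = 1.
Proof.
rewrite (sum_prod_ffun (fun i => bernoulli_pmf (q i))) big1// => i _.
by rewrite /bernoulli_pmf addrC subrK.
Qed.

Lemma hamming_ge1 x y : x != y -> 1 <= hamming x y.
Proof.
move=> xy; have [i xyi] : exists i, x i != y i.
  apply/existsP; apply: contraR xy; rewrite negb_exists => /forallP xy.
  by apply/eqP/ffunP => i; apply/eqP; have := xy i; rewrite negbK.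
by rewrite /hamming (bigD1 i)//= xyi lerDl sumr_ge0.
Qed.

Lemma hamming_le x y : hamming x y <= #|I|%:R.
Proof.
rewrite /hamming -sum1_card natr_sum; apply: ler_sum => i _.
by rewrite ler_nat leq_b1.
Qed.

(* The maximal coupling of [Ber q] and [Ber r]. *)
Let couple (q r : R) (b c : bool) : R :=
  if b then (if c then Num.min q r else q - Num.min q r)
  else (if c then r - Num.min q r else 1 - Num.max q r).

Let coupleE q r y : bern q y = \sum_(z : {ffun I -> bool}) \prod_i couple (q i) (r i) (y i) (z i).
Proof.
rewrite (sum_prod_ffun (fun i => couple (q i) (r i) (y i))).
apply: eq_bigr => i _; rewrite /couple /bernoulli_pmf.
case: (y i); first by rewrite addrC subrK.
by have := addr_min_max (q i) (r i); lra.
Qed.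

Let coupleE' q r z : bern r z = \sum_(y : {ffun I -> bool}) \prod_i couple (q i) (r i) (y i) (z i).
Proof.
rewrite (sum_prod_ffun (fun i => (couple (q i) (r i))^~ (z i))).
apply: eq_bigr => i _; rewrite /couple /bernoulli_pmf.
case: (z i); first by rewrite addrC subrK.
by have := addr_min_max (q i) (r i); lra.
Qed.

Let couple_ge0 (q r : R) b c : 0 <= q <= 1 -> 0 <= r <= 1 -> 0 <= couple q r b c.
Proof.
move=> /andP[q0 q1] /andP[r0 r1]; rewrite /couple.
by case: b; case: c; rewrite ?subr_ge0 ?le_min ?ge_min ?ge_max ?q0 ?r0 ?q1 ?r1 ?lexx ?orbT.
Qed.

(** Under independent copies of [couple], coordinate [i] disagrees with probability [|q i - r i|],
    so the expected Hamming distance is the sum on the right. *)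
Lemma bern_lipschitz q r (f : {ffun I -> bool} -> R) (L : R) :
  is_rate q -> is_rate r -> 0 <= L ->
  (forall x y, `|f x - f y| <= L * hamming x y) ->
  `|\sum_y bern q y * f y - \sum_y bern r y * f y|
    <= L * \sum_i `|q i - r i|.
Proof.
move=> qr rr L0 fL.
pose c y z := \prod_i couple (q i) (r i) (y i) (z i).
have c0 y z : 0 <= c y z.
  by apply: prodr_ge0 => i _; exact: couple_ge0 (qr i) (rr i).
have -> : \sum_y bern q y * f y = \sum_y \sum_z c y z * f y.
  by apply: eq_bigr => y _; rewrite (coupleE q r) mulr_suml.
have -> : \sum_z bern r z * f z = \sum_y \sum_z c y z * f z.
  rewrite exchange_big; apply: eq_bigr => z _.
  by rewrite (coupleE' q r) mulr_suml.
rewrite -sumrB.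
under eq_bigr do rewrite -sumrB.
apply: (@le_trans _ _ (\sum_y \sum_z c y z * (L * hamming y z))).
  apply: (le_trans (ler_norm_sum _ _ _)); apply: ler_sum => y _.
  apply: (le_trans (ler_norm_sum _ _ _)); apply: ler_sum => z _.
  by rewrite -mulrBr normrM ger0_norm// ler_wpM2l.
have -> : \sum_y \sum_z c y z * (L * hamming y z)
    = L * \sum_i \sum_y \sum_z c y z * (y i != z i)%:R.
  rewrite exchange_big [in RHS]mulr_sumr.
  under [in RHS]eq_bigr do rewrite exchange_big mulr_sumr.
  rewrite [RHS]exchange_big; apply: eq_bigr => z _.
  under [RHS]eq_bigr do rewrite mulr_sumr.
  rewrite [RHS]exchange_big; apply: eq_bigr => y _.
  rewrite /hamming !mulr_sumr; apply: eq_bigr => i _; by rewrite mulrCA.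
rewrite ler_wpM2l//; apply: ler_sum => i _.
(* The indicator of disagreement at [i] is absorbed into the factor [i], so the double sum
   factorises; every other factor sums to [1]. *)
pose F j b d : R := couple (q j) (r j) b d * (if j == i then (b != d)%:R else 1).
have E y z : c y z * (y i != z i)%:R = \prod_j F j (y j) (z j).
  rewrite big_split/=; congr (_ * _).
  by rewrite (bigD1 i)//= eqxx big1 ?mulr1// => j /negPf ->.
under eq_bigr do under eq_bigr do rewrite E.
have E2 y : \sum_(z : {ffun I -> bool}) \prod_j F j (y j) (z j) = \prod_j (F j (y j) true + F j (y j) false).
  by rewrite (sum_prod_ffun (fun j => F j (y j))).
under eq_bigr do rewrite E2.
rewrite (sum_prod_ffun (fun j b => F j b true + F j b false)).
rewrite (bigD1 i)//= big1 ?mulr1; last first.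
  move=> j /negPf ji; rewrite /F ji /couple.
  by have := addr_min_max (q j) (r j); lra.
rewrite /F eqxx /couple /= !mulr0 !mulr1 add0r addr0.
by case: (leP (q i) (r i)) => h;
  [rewrite ler0_norm ?subr_le0|rewrite gtr0_norm ?subr_gt0]; try lra.
Qed.

Definition flip (j : I) y : {ffun I -> bool} :=
  [ffun i => if i == j then ~~ y i else y i].

Lemma flipK j : involutive (flip j).
Proof.
by move=> y; apply/ffunP => i; rewrite !ffunE; case: eqP => // _; rewrite negbK.
Qed.

(** Invariance under [flip j] encodes that [g] does not depend on coordinate [j]. The flip exchanges
    the two halves of the sum, which then differ only by the weight of [y j]. *)
Lemma bern_indep q (j : I) (b : bool) (g : {ffun I -> bool} -> R) :
  (forall y, g (flip j y) = g y) ->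
  \sum_y bern q y * ((y j == b)%:R * g y)
    = bernoulli_pmf (q j) b * \sum_y bern q y * g y.
Proof.
move=> gj.
pose w y := \prod_(i | i != j) bernoulli_pmf (q i) (y i).
have wj y : w (flip j y) = w y.
  by apply: eq_bigr => i /negPf ij; rewrite ffunE ij.
pose A c := \sum_(y : {ffun I -> bool} | y j == c) w y * g y.
have AE c : A c = A (~~ c).
  rewrite /A (reindex_inj (inv_inj (flipK j))).
  apply: eq_big => [y|y _]; first by rewrite ffunE eqxx; case: (y j); case: c.
  by rewrite wj gj.
have split_sum (G : {ffun I -> bool} -> R) :
    \sum_y G y = \sum_(y : {ffun I -> bool} | y j == b) G y + \sum_(y : {ffun I -> bool} | y j == ~~ b) G y.
  rewrite (bigID (fun y => y j == b))/=; congr (_ + _).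
  by apply: eq_bigl => y; case: (y j); case: b.
have bw c y : y j == c -> bern q y = bernoulli_pmf (q j) c * w y.
  by move=> /eqP <-; rewrite /bern (bigD1 j).
have half c : \sum_(y : {ffun I -> bool} | y j == c) bern q y * g y = bernoulli_pmf (q j) c * A c.
  by rewrite mulr_sumr; apply: eq_bigr => y yc; rewrite (bw c)// mulrA.
have -> : \sum_y bern q y * ((y j == b)%:R * g y)
    = \sum_(y : {ffun I -> bool} | y j == b) bern q y * g y.
  rewrite split_sum [X in _ + X]big1 ?addr0.
    by apply: eq_bigr => y ->; rewrite mul1r.
  by move=> y /eqP ->; case: b {split_sum}; rewrite /= mul0r mulr0.
rewrite [in RHS]split_sum !half -AE -mulrDl.
have -> : bernoulli_pmf (q j) b + bernoulli_pmf (q j) (~~ b) = 1.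
  by case: b {split_sum}; rewrite /bernoulli_pmf/=; lra.
by rewrite mul1r.
Qed.

(* [E[1{y_j = b_j} / (1 + Z_j)] = P(y_j = b_j) E[1 / (1 + Z_j)]] where [Z_j]
   counts the successes off [j]; on [y_j = b_j] one has [1 + Z_j = Z], so the
   left-hand sides sum to at most [1]. *)
Lemma bern_inv_count q (A : {set I}) (b : I -> bool) (s : R) :
  is_rate q -> 0 < s -> s <= \sum_(j in A) bernoulli_pmf (q j) (b j) ->
  \sum_y bern q y * (1 + \sum_(j in A) (y j == b j)%:R)^-1 <= s^-1.
Proof.
move=> qr s0 sA.
pose Z y : R := \sum_(j in A) (y j == b j)%:R.
pose Zj j y : R := \sum_(i in A | i != j) (y i == b i)%:R.
have Zj0 j y : 0 <= Zj j y by exact: sumr_ge0.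
have Z0 y : 0 <= Z y by exact: sumr_ge0.
have ZE j y : j \in A -> Z y = (y j == b j)%:R + Zj j y.
  by move=> jA; rewrite /Z (bigD1 j).
set E := \sum_y _.
have E0 : 0 <= E.
  by apply: sumr_ge0 => y _; rewrite mulr_ge0 ?bern_ge0// invr_ge0 addr_ge0//; exact: Z0.
suff : s * E <= 1 by move=> sE; rewrite -[leRHS]mul1r ler_pdivlMr// mulrC.
apply: (le_trans (ler_wpM2r E0 sA)); rewrite mulr_suml.
apply: (@le_trans _ _ (\sum_(j in A) \sum_y
    bern q y * ((y j == b j)%:R * (1 + Zj j y)^-1))).
  apply: ler_sum => j jA; rewrite bern_indep; last first.
    move=> y; congr (_ ^-1); congr (_ + _); apply: eq_bigr => i /andP[_ /negPf ij].
    by rewrite ffunE ij.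
  rewrite ler_wpM2l ?bernoulli_pmf_ge0//; apply: ler_sum => y _.
  rewrite ler_wpM2l ?bern_ge0// lef_pV2 ?posrE ?ltr_pwDl//; last exact: Z0.
  by rewrite lerD2l -/(Z y) (ZE j)// lerDr.
rewrite exchange_big/= -[leRHS](sum_bern q); apply: ler_sum => y _.
rewrite -mulr_sumr ler_piMr ?bern_ge0//.
have [Z00|Zn0] := eqVneq (Z y) 0.
  rewrite big1 ?ler01// => j jA; apply/eqP; rewrite mulf_eq0; apply/orP; left.
  have := ZE j y jA; rewrite Z00 => /esym/eqP; by rewrite paddr_eq0 ?ler0n// => /andP[].
have -> : \sum_(j in A) (y j == b j)%:R / (1 + Zj j y)
    = \sum_(j in A) (y j == b j)%:R / Z y.
  apply: eq_bigr => j jA; rewrite (ZE j)//.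
  by case: (y j == b j); rewrite /= ?mul0r ?mul1r.
by rewrite -mulr_suml divff.
Qed.

(** Complements [bern_inv_count] when the mean count [s] is small: for [s <= 1] one has [t <= 2] and
    the expectation is at most [1]; for [s > 1], [1 / s <= 2 / (1 + s)]. *)
Lemma bern_inv_count_le q (A : {set I}) (b : I -> bool) (t : R) :
  is_rate q -> 0 < t -> t <= 1 + \sum_(j in A) bernoulli_pmf (q j) (b j) ->
  \sum_y bern q y * (1 + \sum_(j in A) (y j == b j)%:R)^-1 <= 2 / t.
Proof.
move=> qr t0; set s := \sum_(j in A) _ => ts.
have [s1|s1] := leP s 1; last first.
  have s0 : 0 < s by apply: lt_trans s1.
  apply: le_trans (bern_inv_count qr s0 (lexx _)) _.
  by rewrite -[leLHS]mul1r ler_pdivrMr// mulrAC ler_pdivlMr// mul1r; lra.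
apply: (@le_trans _ _ 1); last by rewrite ler_pdivlMr// mul1r; lra.
rewrite -[leRHS](sum_bern q); apply: ler_sum => y _.
by rewrite ler_piMr ?bern_ge0// invf_le1 ?lerDl ?ltr_pwDl ?sumr_ge0.
Qed.

End ProductBernoulli.

(** * Path sums of a kernel *)

Lemma cauchy_schwarz_sum {R : realType} (V : finType) (a b : V -> R) :
  (forall x, 0 <= a x) -> (forall x, 0 <= b x) ->
  \sum_x Num.sqrt (a x * b x) <= Num.sqrt ((\sum_x a x) * \sum_x b x).
Proof.
move=> a0 b0.
have S0 : 0 <= \sum_x Num.sqrt (a x * b x) by apply: sumr_ge0 => *; exact: sqrtr_ge0.
rewrite -[leLHS]ger0_norm// -sqrtr_sqr ler_sqrt; last first.
  by rewrite mulr_ge0// sumr_ge0.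
pose u x := Num.sqrt (a x); pose v x := Num.sqrt (b x).
have aE x : a x = u x ^+ 2 by rewrite sqr_sqrtr.
have bE x : b x = v x ^+ 2 by rewrite sqr_sqrtr.
have -> : \sum_x Num.sqrt (a x * b x) = \sum_x u x * v x.
  by apply: eq_bigr => x _; rewrite sqrtrM.
under [X in _ <= X * _]eq_bigr do rewrite aE.
under [X in _ <= _ * X]eq_bigr do rewrite bE.
have : 0 <= \sum_x \sum_y (u x * v y - u y * v x) ^+ 2.
  by apply: sumr_ge0 => x _; apply: sumr_ge0 => y _; exact: sqr_ge0.
have prodE (f g : V -> R) :
    (\sum_x f x) * (\sum_y g y) = \sum_x \sum_y f x * g y.
  by rewrite mulr_suml; apply: eq_bigr => x _; rewrite mulr_sumr.
(* Lagrange's identity. *)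
suff -> : \sum_x \sum_y (u x * v y - u y * v x) ^+ 2
    = 2 * ((\sum_x u x ^+ 2) * (\sum_x v x ^+ 2) - (\sum_x u x * v x) ^+ 2).
  by rewrite pmulr_rge0 ?subr_ge0.
rewrite mulrBr mulr2n mulrDl mul1r [X in _ + X - _]mulrC expr2 !prodE.
rewrite mulr_sumr -sumrN -!big_split/=; apply: eq_bigr => x _.
rewrite mulr_sumr -sumrN -!big_split/=; apply: eq_bigr => y _.
by ring.
Qed.

Section Paths.
Context {R : realType} {V : finType}.
Implicit Types (K G M : V -> V -> R) (phi : seq V -> R) (x y : V).

Definition stochastic K := forall x, (forall y, 0 <= K x y) /\ \sum_y K x y = 1.

(** [phi] reads the [n] states visited after [x], without [x] itself. The rows of [K] may have any
    sum, so that the recursion also applies to the affinity kernel. *)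
Fixpoint Epath K (n : nat) phi x : R :=
  if n is n'.+1 then \sum_y K x y * Epath K n' (fun s => phi (y :: s)) y
  else phi [::].

Lemma Epath_ge0 K n phi x :
  (forall x y, 0 <= K x y) -> (forall s, 0 <= phi s) -> 0 <= Epath K n phi x.
Proof.
move=> K0; elim: n phi x => [|n IHn] phi x phi0 //=.
by apply: sumr_ge0 => y _; rewrite mulr_ge0// IHn.
Qed.

Lemma EpathD K n phi psi x :
  Epath K n (fun s => phi s + psi s) x = Epath K n phi x + Epath K n psi x.
Proof.
elim: n phi psi x => [|n IHn] phi psi x //=.
by rewrite -big_split/=; apply: eq_bigr => y _; rewrite IHn mulrDr.
Qed.

Lemma Epath1 K n x : stochastic K -> Epath K n (fun=> 1) x = 1.
Proof.
move=> Ks; elim: n x => [|n IHn] x //=.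
by under eq_bigr do rewrite IHn mulr1; case: (Ks x).
Qed.

Lemma Epath_le1 K n phi x : stochastic K -> (forall s, 0 <= phi s <= 1) ->
  0 <= Epath K n phi x <= 1.
Proof.
move=> Ks phi01.
have K0 x' y : 0 <= K x' y by case: (Ks x').
rewrite Epath_ge0/=; [|by []|by move=> s; case/andP: (phi01 s)].
rewrite -(Epath1 n x Ks) -subr_ge0.
have -> : Epath K n (fun=> 1) x
    = Epath K n (fun s => phi s + (1 - phi s)) x.
  by congr (Epath K n _ x); apply/funext => s; rewrite addrC subrK.
rewrite EpathD addrAC subrr add0r Epath_ge0// => s.
by rewrite subr_ge0; case/andP: (phi01 s).
Qed.

Definition affinity_kernel K K' x y := Num.sqrt (K x y * K' x y).

(** Cauchy-Schwarz over the next state at each step of the induction. *)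
Lemma Epath_affinity K K' n phi x :
  (forall x y, 0 <= K x y) -> (forall x y, 0 <= K' x y) ->
  (forall s, 0 <= phi s) ->
  Epath (affinity_kernel K K') n phi x
    <= Num.sqrt (Epath K n phi x * Epath K' n phi x).
Proof.
move=> K0 K'0; elim: n phi x => [|n IHn] phi x phi0 /=.
  by rewrite -expr2 sqrtr_sqr ger0_norm.
apply: le_trans (cauchy_schwarz_sum _ _); first last.
- by move=> y; rewrite mulr_ge0// Epath_ge0.
- by move=> y; rewrite mulr_ge0// Epath_ge0.
apply: ler_sum => y _; rewrite mulrACA sqrtrM ?mulr_ge0//.
by rewrite ler_wpM2l ?sqrtr_ge0// IHn.
Qed.

(** Le Cam's bound for the test [phi] with errors [a] and [b]. After splitting [1] as
    [phi + (1 - phi)], [Epath_affinity] bounds the total affinity by [sqrt a + sqrt b], whose square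
    is at most [2 (a + b)]. *)
Lemma Epath_test K K' n phi x :
  stochastic K -> stochastic K' -> (forall s, 0 <= phi s <= 1) ->
  (Epath (affinity_kernel K K') n (fun=> 1) x) ^+ 2 / 2
    <= Epath K n phi x + Epath K' n (fun s => 1 - phi s) x.
Proof.
move=> Ks K's phi01.
have K0 x' y : 0 <= K x' y by case: (Ks x').
have K'0 x' y : 0 <= K' x' y by case: (K's x').
have phi0 s : 0 <= phi s by case/andP: (phi01 s).
have psi0 s : 0 <= 1 - phi s by rewrite subr_ge0; case/andP: (phi01 s).
have psi01 s : 0 <= 1 - phi s <= 1 by rewrite psi0 gerBl phi0.
have G0 x' y : 0 <= affinity_kernel K K' x' y by exact: sqrtr_ge0.
set W := Epath _ n (fun=> 1) x; set a := Epath K n phi x; set b := Epath K' n _ x.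
have a0 : 0 <= a by exact: Epath_ge0.
have b0 : 0 <= b by exact: Epath_ge0.
have W0 : 0 <= W by apply: Epath_ge0.
have : W <= Num.sqrt a + Num.sqrt b.
  have -> : W = Epath (affinity_kernel K K') n (fun s => phi s + (1 - phi s)) x.
    by congr (Epath _ n _ x); apply/funext => s; rewrite addrC subrK.
  rewrite EpathD lerD// (le_trans (Epath_affinity _ _ _ _ _))// ler_sqrt//.
    by rewrite ler_piMr//; case/andP: (Epath_le1 n x K's phi01).
  by rewrite ler_piMl//; case/andP: (Epath_le1 n x Ks psi01).
move=> Wab; have sa := sqr_sqrtr a0; have sb := sqr_sqrtr b0.
have : W ^+ 2 <= (Num.sqrt a + Num.sqrt b) ^+ 2.
  by rewrite ler_sqr ?nnegrE ?addr_ge0 ?sqrtr_ge0.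
have := sqr_ge0 (Num.sqrt a - Num.sqrt b); nra.
Qed.

(** A function with values in [[0, 1]] is [1]-Lipschitz because distinct states are at distance at
    least [1]; each of the [m] ignored steps multiplies the Lipschitz constant by [rho]. *)
Lemma Epath_drop_lipschitz K (dist : V -> V -> R) (rho : R) m n phi :
  stochastic K -> 0 <= rho ->
  (forall x y, x != y -> 1 <= dist x y) -> (forall x, 0 <= dist x x) ->
  (forall (f : V -> R) L, 0 <= L -> (forall x y, `|f x - f y| <= L * dist x y) ->
    forall x y, `|\sum_z K x z * f z - \sum_z K y z * f z| <= L * rho * dist x y) ->
  (forall s, 0 <= phi s <= 1) ->
  forall x y, `|Epath K (m + n) (fun s => phi (drop m s)) x
      - Epath K (m + n) (fun s => phi (drop m s)) y| <= rho ^+ m * dist x y.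
Proof.
move=> Ks rho0 d1 d0 Klip phi01; elim: m => [|m IHm] x y.
  rewrite add0n expr0 mul1r.
  have -> : (fun s => phi (drop 0 s)) = phi by apply/funext => s; rewrite drop0.
  have [->|xy] := eqVneq x y; first by rewrite subrr normr0.
  apply: le_trans (d1 _ _ xy).
  have /andP[] := Epath_le1 n x Ks phi01; have /andP[] := Epath_le1 n y Ks phi01.
  by rewrite ler_norml; lra.
rewrite addSn /= exprSr.
by apply: Klip; rewrite ?exprn_ge0.
Qed.

Lemma jensen_expR (w a : V -> R) : (forall x, 0 <= w x) -> \sum_x w x = 1 ->
  expR (\sum_x w x * a x) <= \sum_x w x * expR (a x).
Proof.
move=> w0 w1; set c := \sum_x w x * a x.
(* [expR c] is the mean of the tangent of [expR] at [c]. *)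
have -> : expR c = \sum_x w x * (expR c * (1 + (a x - c))).
  rewrite -[LHS]mulr1.
  under eq_bigr do rewrite mulrCA.
  rewrite -mulr_sumr; congr (_ * _).
  under eq_bigr do rewrite addrCA mulrDr.
  rewrite big_split/= -/c.
  by rewrite -mulr_suml w1 mul1r addrCA subrr addr0.
apply: ler_sum => x _; rewrite ler_wpM2l//.
rewrite [X in _ <= expR X](_ : _ = c + (a x - c)); last by rewrite addrC subrK.
rewrite expRD ler_wpM2l ?expR_ge0//.
exact: expR_ge1Dx.
Qed.

(** The first step costs [h x]. For each of the [n] later steps, Jensen's inequality moves the mean
    of [h] under [M], at most [c], into the exponent. *)
Lemma Epath_exp_lower G M (h : V -> R) (c : R) n x :
  stochastic M -> (forall x y, expR (- h x) * M x y <= G x y) ->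
  (forall x, \sum_y M x y * h y <= c) ->
  expR (- (h x + n%:R * c)) <= Epath G n.+1 (fun=> 1) x.
Proof.
move=> Ms GM Mh.
have M0 x' y : 0 <= M x' y by case: (Ms x').
have G0 x' y : 0 <= G x' y.
  by apply: le_trans (GM x' y); rewrite mulr_ge0 ?expR_ge0.
elim: n x => [|n IHn] x.
  rewrite mul0r addr0 /=; under eq_bigr do rewrite mulr1.
  apply: (@le_trans _ _ (\sum_y expR (- h x) * M x y)); last exact: ler_sum.
  by rewrite -mulr_sumr; case: (Ms x) => _ ->; rewrite mulr1.
change (expR (- (h x + n.+1%:R * c))
  <= \sum_y G x y * Epath G n.+1 (fun=> 1) y).
apply: (@le_trans _ _ (\sum_y expR (- h x) * M x y * expR (- (h y + n%:R * c)))).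
  under eq_bigr do rewrite -mulrA.
  rewrite -mulr_sumr opprD expRD ler_wpM2l ?expR_ge0//.
  have Mx1 : \sum_y M x y = 1 by case: (Ms x).
  apply: le_trans (jensen_expR (fun y => - (h y + n%:R * c)) (M0 x) Mx1).
  rewrite ler_expR.
  under eq_bigr do rewrite mulrN mulrDr.
  rewrite sumrN lerN2 big_split/= -mulr_suml.
  by case: (Ms x) => _ ->; rewrite mul1r -natr1 mulrDl mul1r addrC lerD2l.
apply: ler_sum => y _; apply: ler_pM.
- by rewrite mulr_ge0 ?expR_ge0.
- exact: expR_ge0.
- exact: GM.
- exact: IHn.
Qed.

End Paths.

(** * Hellinger affinity of Bernoulli laws *)

Section Hellinger.
Context {R : realType}.
Implicit Types (q r t mu : R).

(** The Hellinger affinity (Bhattacharyya coefficient) of [Ber q] and [Ber r]. *)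
Definition hell q r : R := Num.sqrt (q * r) + Num.sqrt ((1 - q) * (1 - r)).

(* The normalised geometric mean of [Ber q] and [Ber r] is [Ber (geo q r)]. *)
Definition geo q r : R := Num.sqrt (q * r) / hell q r.

Lemma sqrt_mul_ge t q r : 0 <= t -> t <= q -> t <= r -> t <= Num.sqrt (q * r).
Proof.
move=> t0 tq tr; rewrite -[leLHS]ger0_norm// -sqrtr_sqr ler_sqrt; last first.
  by rewrite mulr_ge0 ?(le_trans t0).
by rewrite expr2 ler_pM.
Qed.

Lemma sqrt_mul_le t q r : 0 <= q -> 0 <= r -> q <= t -> r <= t ->
  Num.sqrt (q * r) <= t.
Proof.
move=> q0 r0 qt rt; have t0 := le_trans q0 qt.
by rewrite -[leRHS]ger0_norm// -sqrtr_sqr ler_sqrt ?sqr_ge0// expr2 ler_pM.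
Qed.

(** The left-hand side is [(sqrt q - sqrt r)^2], that is [(q - r)^2 / (sqrt q + sqrt r)^2], and the
    denominator is at least [q + r >= t]. *)
Lemma sqrt_mul_gap t q r : 0 <= q -> 0 <= r -> 0 < t -> t <= q \/ t <= r ->
  q + r - 2 * Num.sqrt (q * r) <= (q - r) ^+ 2 / t.
Proof.
move=> q0 r0 t0 tqr; rewrite sqrtrM// ler_pdivlMr//.
have qE := sqr_sqrtr q0; have rE := sqr_sqrtr r0.
have sq0 := sqrtr_ge0 q; have sr0 := sqrtr_ge0 r.
move: (Num.sqrt q) (Num.sqrt r) qE rE sq0 sr0 => a b qE rE a0 b0.
have ab0 : 0 <= a * b by rewrite mulr_ge0.
have tab : t <= (a + b) ^+ 2.
  have := sqr_ge0 a; have := sqr_ge0 b; rewrite qE rE sqrrD qE rE mulr2n; lra.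
have -> : (q - r) ^+ 2 = (a - b) ^+ 2 * (a + b) ^+ 2 by rewrite -qE -rE; ring.
have -> : q + r - 2 * (a * b) = (a - b) ^+ 2 by rewrite -qE -rE; ring.
by rewrite ler_wpM2l ?sqr_ge0.
Qed.

Section bounds.
Context (mu q r : R).
Hypotheses (mu0 : 0 < mu) (muq : mu <= q <= 1) (mur : mu <= r <= 1).

Lemma hell_ge : mu <= hell q r.
Proof.
move/andP: muq => [? _]; move/andP: mur => [? _].
by rewrite /hell ler_wpDr ?sqrtr_ge0// sqrt_mul_ge// ltW.
Qed.

Lemma hell_gt0 : 0 < hell q r.
Proof. exact: lt_le_trans mu0 hell_ge. Qed.

Lemma hell_le1 : hell q r <= 1.
Proof.
move/andP: muq => [? ?]; move/andP: mur => [? ?].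
have gm (a b : R) : 0 <= a -> 0 <= b -> 2 * Num.sqrt (a * b) <= a + b.
  move=> a0 b0; rewrite sqrtrM//.
  have := sqr_ge0 (Num.sqrt a - Num.sqrt b).
  by rewrite sqrrB !sqr_sqrtr// mulr2n; lra.
have m0 := mu0; have q0 : 0 <= q by lra.
have r0 : 0 <= r by lra.
have q1 : 0 <= 1 - q by lra.
have r1 : 0 <= 1 - r by lra.
have := gm _ _ q0 r0; have := gm _ _ q1 r1; rewrite /hell; lra.
Qed.

Lemma geo_ge : mu <= geo q r.
Proof.
move/andP: muq => [? _]; move/andP: mur => [? _].
rewrite /geo ler_pdivlMr ?hell_gt0//.
apply: (@le_trans _ _ mu); last by rewrite sqrt_mul_ge// ltW.
by rewrite ler_piMr ?hell_le1// ltW.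
Qed.

Lemma subr_geo : 1 - geo q r = Num.sqrt ((1 - q) * (1 - r)) / hell q r.
Proof.
by rewrite -[X in X - _](divff (lt0r_neq0 hell_gt0)) -mulrBl /hell addrAC subrr add0r.
Qed.

Lemma geo_le1 : geo q r <= 1.
Proof.
rewrite -subr_ge0 subr_geo divr_ge0 ?sqrtr_ge0//; exact: ltW hell_gt0.
Qed.

Lemma subr_geo_ge t : 0 <= t -> t <= 1 - q -> t <= 1 - r -> t <= 1 - geo q r.
Proof.
move=> t0 tq tr; rewrite subr_geo ler_pdivlMr ?hell_gt0//.
by apply: le_trans (sqrt_mul_ge t0 tq tr); rewrite ler_piMr ?hell_le1.
Qed.

Lemma subr_geo_le t : 1 - q <= t -> 1 - r <= t -> 1 - geo q r <= t / mu.
Proof.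
move=> qt rt; move/andP: muq => [? ?]; move/andP: mur => [? ?].
have t0 : 0 <= t by lra.
have m0 := mu0; rewrite subr_geo; apply: ler_pM; rewrite ?sqrtr_ge0 ?invr_ge0 ?(ltW hell_gt0)//.
  by rewrite sqrt_mul_le// subr_ge0.
by rewrite lef_pV2 ?posrE ?hell_gt0 ?hell_ge.
Qed.

Lemma sqrt_bernoulli_pmf b :
  Num.sqrt (bernoulli_pmf q b * bernoulli_pmf r b)
    = hell q r * bernoulli_pmf (geo q r) b.
Proof.
rewrite /bernoulli_pmf; case: b.
  by rewrite /geo [RHS]mulrC divfK// gt_eqF ?hell_gt0.
by rewrite subr_geo [RHS]mulrC divfK// gt_eqF ?hell_gt0.
Qed.

End bounds.

(* The failure probabilities [1 - q], [1 - r] are [delta + c B / n] and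
   [delta + c B' / n]. When [B <> B'] the larger of them is of order at least
   [(1 + D) / n] while they differ by at most [2 / n], so the affinity is
   [1 - O(1 / (n (1 + D)))]. *)
Lemma hell_expR mu delta c n D B B' q r :
  0 < mu -> 0 <= delta -> 0 < c <= 1 -> 0 <= D -> D + 1 <= n ->
  D <= B <= D + 2 -> D <= B' <= D + 2 -> B = B' \/ 1 <= `|B - B'| ->
  1 - q = delta + c / n * B -> 1 - r = delta + c / n * B' ->
  mu <= q <= 1 -> mu <= r <= 1 ->
  expR (- ((B != B')%:R * (4 / mu ^+ 2 / (n * (1 + D))))) <= hell q r.
Proof.
move=> mu0 de0 /andP[c0 c1] D0 Dn /andP[DB BD] /andP[DB' BD'] BB' qE rE muq mur.
have n0 : 0 < n by apply: lt_le_trans Dn; rewrite ltr_wpDl.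
have [q0 q1] := andP muq; have [r0 r1] := andP mur.
have q00 : 0 <= q by rewrite (le_trans _ q0)// ltW.
have r00 : 0 <= r by rewrite (le_trans _ r0)// ltW.
have [BE|Bn] := eqVneq B B'.
  have -> : q = r by move: qE; rewrite BE -rE => /addrI/oppr_inj.
  rewrite mul0r oppr0 expR0 /hell -!expr2 !sqrtr_sqr !ger0_norm ?subr_ge0//.
  by rewrite addrC subrK.
rewrite mul1r.
case: BB' => [BE|BB']; first by rewrite BE eqxx in Bn.
set Z := hell q r.
have Z0 : 0 < Z := hell_gt0 mu0 muq mur.
have Zmu : mu <= Z := hell_ge mu0 muq mur.
set k := n * (1 + D).
have D1 : 0 < 1 + D by rewrite ltr_pwDl.
have k0 : 0 < k by rewrite mulr_gt0.
pose e := 4 / (mu * k).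
have mu1 : mu <= 1 by exact: le_trans q0 q1.
have t0 : 0 < c * (1 + D) / n by rewrite divr_gt0// mulr_gt0.
(* The success probabilities are at least [mu]. One of the failure probabilities is at least
   [c (1 + D) / n], since [B] and [B'] are at least [D] and differ by at least [1]. *)
have gap1 := sqrt_mul_gap q00 r00 mu0 (or_introl q0).
have gap2 : (1 - q) + (1 - r) - 2 * Num.sqrt ((1 - q) * (1 - r))
    <= (r - q) ^+ 2 / (c * (1 + D) / n).
  have -> : r - q = (1 - q) - (1 - r) by ring.
  apply: sqrt_mul_gap; rewrite ?subr_ge0//.
  have cn : 0 < c / n by rewrite divr_gt0.
  have big : 1 + D <= B \/ 1 + D <= B'.
    move: BB'; rewrite ler_normr => /orP[] h; [left|right]; lra.
  rewrite qE rE mulrAC; case: big => h; [left|right];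
    by rewrite ler_wpDl// ler_wpM2l// ltW.
have dqr : (q - r) ^+ 2 <= 4 * c ^+ 2 / n ^+ 2.
  have -> : q - r = c / n * (B' - B) by move: qE rE; lra.
  rewrite !exprMn exprVn.
  have sq4 : (B' - B) ^+ 2 <= 4.
    have : 0 <= (2 - (B' - B)) * (2 + (B' - B)) by apply: mulr_ge0; lra.
    lra.
  have : 0 <= c ^+ 2 * (n ^+ 2)^-1 by rewrite mulr_ge0 ?invr_ge0 ?sqr_ge0.
  by move=> cn; rewrite [leLHS]mulrC -[leRHS]mulrA ler_wpM2r.
have e1 : (q - r) ^+ 2 / mu <= e.
  apply: (@le_trans _ _ (4 * c ^+ 2 / n ^+ 2 / mu)).
    by rewrite ler_wpM2r// invr_ge0 ltW.
  rewrite -mulrA -invfM /e ler_pM//.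
  - by rewrite mulr_ge0// sqr_ge0.
  - by rewrite invr_ge0 mulr_ge0 ?sqr_ge0 1?ltW.
  - by rewrite ler_piMr// expr_le1// ltW.
  rewrite lef_pV2 ?posrE ?mulr_gt0 ?exprn_gt0// mulrC ler_wpM2r ?(ltW mu0)//.
  by rewrite expr2 /k ler_wpM2l ?(ltW n0)// addrC.
have e2 : (r - q) ^+ 2 / (c * (1 + D) / n) <= e.
  rewrite -sqrrN opprB.
  apply: (@le_trans _ _ (4 * c ^+ 2 / n ^+ 2 / (c * (1 + D) / n))).
    by rewrite ler_wpM2r// invr_ge0 ltW.
  have -> : 4 * c ^+ 2 / n ^+ 2 / (c * (1 + D) / n) = 4 * (c / k).
    by rewrite /k; field; rewrite ?gt_eqF.
  rewrite /e ler_wpM2l// [leRHS]invfM ler_wpM2r ?invr_ge0 ?(ltW k0)//.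
  by rewrite (le_trans c1)// invf_ge1.
have Ze : 1 - Z <= e by rewrite /Z /hell; move: gap1 gap2 e1 e2; lra.
have -> : 4 / mu ^+ 2 / k = e / mu by rewrite /e; field; rewrite ?gt_eqF.
(* From [1 - Z <= e] and [mu <= Z] follows [1 / Z <= 1 + e / mu <= expR (e / mu)]. *)
rewrite expRN invf_ple ?posrE ?expR_gt0//.
apply: le_trans (expR_ge1Dx _).
have em : 0 <= e / mu by rewrite !divr_ge0 ?mulr_ge0// ltW.
rewrite -[leLHS]mul1r ler_pdivrMr// mulrDl mul1r.
have : e / mu * mu = e by rewrite divfK// gt_eqF.
have : e / mu * mu <= e / mu * Z by rewrite ler_wpM2l.
move: Ze; lra.
Qed.

Lemma sqrtr_prod (I : Type) (s : seq I) (F : I -> R) : (forall i, 0 <= F i) ->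
  Num.sqrt (\prod_(i <- s) F i) = \prod_(i <- s) Num.sqrt (F i).
Proof.
move=> F0; elim: s => [|i s IHs]; first by rewrite !big_nil sqrtr1.
by rewrite !big_cons sqrtrM// IHs.
Qed.

End Hellinger.

(** * The transition kernel *)

Lemma natr_dist_ge1 {R : realDomainType} (m n : nat) :
  m != n -> 1 <= `|m%:R - n%:R| :> R.
Proof.
rewrite neq_ltn => /orP[] mn.
  by rewrite distrC ger0_norm ?subr_ge0 ?ler_nat ?(ltnW mn)// -natrB ?(ltnW mn)// ler1n subn_gt0.
by rewrite ger0_norm ?subr_ge0 ?ler_nat ?(ltnW mn)// -natrB ?(ltnW mn)// ler1n subn_gt0.
Qed.

Section Kernel.
Context {R : realType} {N : nat}.
Context (mu lambda : R) (lambda01 : 0 < lambda < 1) (mu_lambda : 0 < mu <= lambda).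
Context (a : 'I_N -> 'I_N -> bool).
Local Notation state := {ffun 'I_N -> bool}.
Implicit Types (S U : {set 'I_N}) (i j k l : 'I_N) (x y : state).

Let mu0 : 0 < mu. Proof. by case/andP: mu_lambda. Qed.
Let mule : mu <= lambda. Proof. by case/andP: mu_lambda. Qed.
Let c0 : 0 < 1 - lambda. Proof. by rewrite subr_gt0; case/andP: lambda01. Qed.
Let c1 : 1 - lambda <= 1. Proof. by rewrite gerBl ltW//; case/andP: lambda01. Qed.

Definition kern S x y : R := bern (fun i => rate mu lambda a S i x) y.

(* [j] fails to push coordinate [i] up. *)
Definition bad S i j x : bool := ~~ (a i j && (x j == (j \in S))).

Lemma rateE S i x :
  rate mu lambda a S i x
    = mu + (1 - lambda) / N%:R * \sum_j (~~ bad S i j x)%:R.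
Proof.
rewrite /rate; congr (_ + _ * _).
rewrite [RHS](bigID (mem S))/=; congr (_ + _).
  apply: eq_bigr => j jS; rewrite /bad negbK jS.
  by case: (a i j); case: (x j); rewrite /= ?(mul0r, mul1r).
apply: eq_big => [j|j]; first by rewrite inE.
rewrite inE => /negPf jS; rewrite /bad negbK jS.
by case: (a i j); case: (x j); rewrite /= ?(mul0r, mul1r, subrr, subr0).
Qed.

Lemma subr_rate S i x : (0 < N)%N ->
  1 - rate mu lambda a S i x
    = (lambda - mu) + (1 - lambda) / N%:R * \sum_j (bad S i j x)%:R.
Proof.
move=> N0; rewrite rateE.
have -> : \sum_j (~~ bad S i j x)%:R = N%:R - \sum_j (bad S i j x)%:R :> R.
  have -> : N%:R = \sum_(j < N) 1 :> R by rewrite sumr_const card_ord.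
  rewrite -sumrB.
  by apply: eq_bigr => j _; case: (bad _ _ _ _); rewrite /= ?subrr ?subr0.
by field; rewrite pnatr_eq0 -lt0n.
Qed.

Lemma rate_bounds S i x : mu <= rate mu lambda a S i x <= 1.
Proof.
rewrite rateE; apply/andP; split.
  by rewrite lerDl mulr_ge0 ?sumr_ge0// divr_ge0// ltW.
have N0 : (0 < N)%N by case: N i => // -[].
have N0' : 0 < N%:R :> R by rewrite ltr0n.
have sN : \sum_j (~~ bad S i j x)%:R <= N%:R :> R.
  have -> : N%:R = \sum_(j < N) 1 :> R by rewrite sumr_const card_ord.
  by apply: ler_sum => j _; rewrite lern1 leq_b1.
have : (1 - lambda) / N%:R * \sum_j (~~ bad S i j x)%:R <= 1 - lambda.
  by rewrite mulrAC ler_pdivrMr// ler_wpM2l// ltW.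
have := mule; lra.
Qed.

Lemma rate_is_rate S x : is_rate (fun i => rate mu lambda a S i x).
Proof.
move=> i; have /andP[h ->] := rate_bounds S i x; rewrite andbT.
exact: le_trans (ltW mu0) h.
Qed.

Lemma kern_stochastic S : stochastic (kern S).
Proof.
move=> x; split => [y|]; last exact: sum_bern.
exact: bern_ge0 (rate_is_rate S x).
Qed.

(** Each of the [N] rates moves by at most [(1 - lambda) / N] per site where [x] and [y] differ. *)
Lemma rate_lipschitz S x y :
  \sum_i `|rate mu lambda a S i x - rate mu lambda a S i y|
    <= (1 - lambda) * hamming x y.
Proof.
have [N0|N0] := posnP N.
  rewrite big1 ?mulr_ge0 ?(ltW c0) ?sumr_ge0// => i _.
  by have := ltn_ord i; rewrite [X in (_ < X)%N]N0.
apply: (@le_trans _ _ (\sum_(i < N) (1 - lambda) / N%:R * hamming x y)).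
  apply: ler_sum => i _; rewrite !rateE opprD addrACA subrr add0r -mulrBr.
  rewrite normrM ger0_norm ?divr_ge0 ?(ltW c0)//.
  rewrite ler_wpM2l ?divr_ge0 ?(ltW c0)//.
  rewrite -sumrB (le_trans (ler_norm_sum _ _ _))//; apply: ler_sum => j _.
  by rewrite /bad; case: (a i j); case: (x j); case: (y j); case: (j \in S);
    rewrite /= ?subrr ?normr0 ?subr0 ?sub0r ?normrN ?normr1.
rewrite sumr_const card_ord -[leLHS]mulr_natl mulrA mulrCA divff ?mulr1//.
by rewrite pnatr_eq0 -lt0n.
Qed.

Lemma kern_contract S (f : state -> R) (L : R) : 0 <= L ->
  (forall x y, `|f x - f y| <= L * hamming x y) ->
  forall x y, `|\sum_z kern S x z * f z - \sum_z kern S y z * f z|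
    <= L * (1 - lambda) * hamming x y.
Proof.
move=> L0 fL x y.
apply: le_trans (bern_lipschitz (rate_is_rate S x) (rate_is_rate S y) L0 fL) _.
by rewrite -mulrA ler_wpM2l// rate_lipschitz.
Qed.

Definition nmiss i : R := \sum_j (~~ a i j)%:R.

Lemma nmiss_ge0 i : 0 <= nmiss i. Proof. exact: sumr_ge0. Qed.

Lemma nmiss_le i : nmiss i <= N%:R.
Proof.
have -> : N%:R = \sum_(j < N) 1 :> R by rewrite sumr_const card_ord.
by apply: ler_sum => j _; rewrite lern1 leq_b1.
Qed.

(** * Two communities obtained by deleting one of two points of [U] *)

Section swap.
Context (U : {set 'I_N}) (k l : 'I_N) (kU : k \in U) (lU : l \in U) (kl : k != l).

Let N0 : (0 < N)%N. Proof. by case: N k => // -[]. Qed.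
Let N0' : 0 < N%:R :> R. Proof. by rewrite ltr0n. Qed.

Definition geo_rate x i :=
  geo (rate mu lambda a (U :\ k) i x) (rate mu lambda a (U :\ l) i x).

Definition geo_kern x y : R := bern (geo_rate x) y.

(* [D_i(x)] above: the bad neighbours of [i] common to both communities. *)
Let base i x : R := \sum_(j | (j != k) && (j != l)) (bad U i j x)%:R.

Let nbad S i x : R := \sum_j (bad S i j x)%:R.

Let kappa : R := 4 / mu ^+ 2.

(** The exponent [h] lost against the geometric-mean kernel: the exponents of [hell_expR] with
    [D = base i x], summed over the coordinates. *)
Let loss x : R := \sum_i (nbad (U :\ k) i x != nbad (U :\ l) i x)%:R
                    * (kappa / (N%:R * (1 + base i x))).

Let nbad_split S i x : (forall j, j != k -> j != l -> (j \in S) = (j \in U)) ->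
  nbad S i x = (bad S i k x)%:R + ((bad S i l x)%:R + base i x).
Proof.
move=> SU; rewrite /nbad (bigD1 k)//= (bigD1 l) 1?eq_sym//=; congr (_ + (_ + _)).
by apply: eq_bigr => j /andP[jk jl]; rewrite /bad SU.
Qed.

Let memDk j : j != k -> j != l -> (j \in U :\ k) = (j \in U).
Proof. by move=> jk jl; rewrite !inE jk. Qed.

Let memDl j : j != k -> j != l -> (j \in U :\ l) = (j \in U).
Proof. by move=> jk jl; rewrite !inE jl. Qed.

Let base_ge0 i x : 0 <= base i x. Proof. exact: sumr_ge0. Qed.

Let base_le i x : base i x + 1 <= N%:R.
Proof.
have -> : N%:R = \sum_(j < N) 1 :> R.
  by rewrite sumr_const card_ord.
rewrite [leRHS](bigD1 k)//= [leLHS]addrC lerD2l.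
rewrite [leRHS](bigD1 l) 1?eq_sym//= ler_wpDl//.
by apply: ler_sum => j _; rewrite lern1 leq_b1.
Qed.

Let bool01 (b : bool) : 0 <= (b%:R : R) <= 1.
Proof. by case: b; rewrite ?ler01 lexx. Qed.

Lemma geo_rate_ge x i : mu <= geo_rate x i.
Proof. exact: geo_ge mu0 (rate_bounds _ _ _) (rate_bounds _ _ _). Qed.

Lemma geo_rate_is_rate x : is_rate (geo_rate x).
Proof.
move=> i; apply/andP; split; first exact: le_trans (ltW mu0) (geo_rate_ge x i).
exact: geo_le1 mu0 (rate_bounds _ _ _) (rate_bounds _ _ _).
Qed.

Lemma geo_kern_stochastic : stochastic geo_kern.
Proof.
move=> x; split => [y|]; last exact: sum_bern.
exact: bern_ge0 (geo_rate_is_rate x).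
Qed.

Let affinity_kernel_ge x y :
  expR (- loss x) * geo_kern x y <= affinity_kernel (kern (U :\ k)) (kern (U :\ l)) x y.
Proof.
rewrite /affinity_kernel /kern /bern -big_split/= sqrtr_prod; last first.
  by move=> i; rewrite mulr_ge0// bernoulli_pmf_ge0// rate_is_rate.
under eq_bigr do rewrite (sqrt_bernoulli_pmf mu0 (rate_bounds _ _ _) (rate_bounds _ _ _)).
rewrite big_split/= ler_wpM2r//; first by case: (geo_kern_stochastic x).
rewrite /loss -sumrN expR_sum; apply: ler_prod => i _; rewrite expR_ge0/=.
have := base_le i x; have := base_ge0 i x => b0 bN.
apply: (@hell_expR _ mu (lambda - mu) (1 - lambda) N%:R (base i x)
  (nbad (U :\ k) i x) (nbad (U :\ l) i x)) => //; rewrite ?rate_bounds ?subr_ge0 ?c0 ?c1//.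
- rewrite (nbad_split _ _ memDk); have := bool01 (bad (U :\ k) i k x).
  by have := bool01 (bad (U :\ k) i l x); lra.
- rewrite (nbad_split _ _ memDl); have := bool01 (bad (U :\ l) i k x).
  by have := bool01 (bad (U :\ l) i l x); lra.
- rewrite /nbad -!natr_sum.
  set m := \sum_j _; set n := \sum_j _.
  have [->|mn] := eqVneq m n; [by left|right; exact: natr_dist_ge1].
- by rewrite subr_rate.
- by rewrite subr_rate.
Qed.

(** A site whose state disagrees with its membership in [U] is bad for every [i]; this is the part
    of [base] common to all coordinates. *)
Let mism x : R := \sum_(j | (j != k) && (j != l)) (x j != (j \in U))%:R.

Let mism_ge0 x : 0 <= mism x. Proof. exact: sumr_ge0. Qed.

Let mism_le_base i x : mism x <= base i x.
Proof.
apply: ler_sum => j _; rewrite ler_nat /bad.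
by case: (a i j); case: (x j); case: (j \in U).
Qed.

Let base_le_mism i x : base i x <= mism x + nmiss i.
Proof.
apply: (@le_trans _ _ (mism x + \sum_(j | (j != k) && (j != l)) (~~ a i j)%:R)).
  rewrite -big_split/=; apply: ler_sum => j _; rewrite -natrD ler_nat /bad.
  by case: (a i j); case: (x j); case: (j \in U).
rewrite lerD2l /nmiss [leRHS](bigID (fun j => (j != k) && (j != l)))/= lerDl.
exact: sumr_ge0.
Qed.

Let nmiss_le_base i x : nmiss i <= base i x + 2.
Proof.
rewrite /nmiss (bigD1 k)//= (bigD1 l) 1?eq_sym//=.
have : \sum_(j | (j != k) && (j != l)) (~~ a i j)%:R <= base i x.
  by apply: ler_sum => j _; rewrite ler_nat /bad; case: (a i j).
by have := bool01 (~~ a i k); have := bool01 (~~ a i l); lra.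
Qed.

(** If both links are present and [x k], [x l] are up, then [k] is bad and [l] good for [U :\ k],
    and conversely for [U :\ l]: the two counts agree. *)
Let nbad_diff i x : (nbad (U :\ k) i x != nbad (U :\ l) i x)%:R
  <= (~~ a i k)%:R + (~~ a i l)%:R + ((x k == false)%:R + (x l == false)%:R) :> R.
Proof.
rewrite -!natrD ler_nat.
case E : [&& a i k, a i l, x k & x l]; last first.
  apply: leq_trans (leq_b1 _) _; move: E.
  by case: (a i k); case: (a i l); case: (x k); case: (x l).
have /and4P[aik ail xk xl] := E.
rewrite (nbad_split _ _ memDk) (nbad_split _ _ memDl) /bad !inE aik ail xk xl kU lU.
by rewrite !eqxx ![_ == k]eq_sym (negPf kl)/= addrCA eqxx.
Qed.

Let inv1_le (u v : R) : 0 <= u -> u <= v -> (1 + v)^-1 <= (1 + u)^-1.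
Proof.
move=> u0 uv; rewrite lef_pV2 ?posrE ?lerD2l ?ltr_pwDl//.
exact: le_trans uv.
Qed.

Let kappa0 : 0 < kappa. Proof. by rewrite divr_gt0// exprn_gt0. Qed.

Let kappaN0 : 0 <= kappa / N%:R.
Proof. by rewrite mulr_ge0 ?invr_ge0 ?(ltW kappa0) ?(ltW N0'). Qed.

Let loss_term i x (d e : R) : 0 <= d <= 1 -> 0 <= e -> e <= base i x ->
  d * (kappa / (N%:R * (1 + base i x))) <= kappa / N%:R * (d / (1 + e)).
Proof.
move=> /andP[d0 d1] e0 eb.
have -> : d * (kappa / (N%:R * (1 + base i x))) = kappa / N%:R * (d / (1 + base i x)).
  by rewrite invfM; ring.
by rewrite ler_wpM2l ?kappaN0// ler_wpM2l// inv1_le.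
Qed.

(** The indicator is bounded by [1]; an up site outside [U] is a mismatch, hence bad for every
    [i]. *)
Let loss_outside x : loss x <= kappa * (1 + \sum_(j in ~: U) (x j == true)%:R)^-1.
Proof.
set e := \sum_(j in ~: U) _.
have e0 : 0 <= e by exact: sumr_ge0.
have eb i : e <= base i x.
  apply: le_trans (mism_le_base i x); rewrite /e /mism.
  rewrite [leRHS](bigID (fun j => j \in ~: U))/=.
  rewrite [X in _ <= X + _](eq_bigl (fun j => j \in ~: U)); last first.
    move=> j; rewrite !inE andbC; case: eqVneq => [->|_]; first by rewrite kU.
    by case: eqVneq => [->|_]; rewrite ?lU ?andbT.
  rewrite ler_wpDr ?sumr_ge0//; apply: ler_sum => j; rewrite inE => /negPf ->.
  by case: (x j).
apply: (@le_trans _ _ (\sum_(i < N) kappa / N%:R * (1 + e)^-1)); last first.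
  rewrite sumr_const card_ord -[leLHS]mulr_natl mulrA mulrCA.
  by rewrite divff ?mulr1// gt_eqF.
apply: ler_sum => i _; apply: le_trans (loss_term (bool01 _) e0 (eb i)) _.
rewrite ler_wpM2l ?kappaN0//.
by rewrite ler_piMl ?invr_ge0 ?addr_ge0// lern1 leq_b1.
Qed.

Let inside := U :\ k :\ l.

(** The indicator is split by [nbad_diff]. Missing links are charged to the [nmiss i] contained in
    [base]; the failures of [x k] and [x l] are charged to the down sites of [U], counted without
    [k] and [l] to keep them independent under a product law. *)
Let loss_inside x : loss x
  <= 3 * kappa / N%:R * (\sum_i (~~ a i k)%:R / (1 + nmiss i)
                         + \sum_i (~~ a i l)%:R / (1 + nmiss i))
   + kappa * ((x k == false)%:R * (1 + \sum_(j in inside) (x j == false)%:R)^-1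
              + (x l == false)%:R * (1 + \sum_(j in inside) (x j == false)%:R)^-1).
Proof.
set e := \sum_(j in inside) _.
have e0 : 0 <= e by exact: sumr_ge0.
have eb i : e <= base i x.
  apply: le_trans (mism_le_base i x); rewrite /e /mism.
  rewrite [leRHS](bigID (fun j => j \in U))/=.
  rewrite [X in _ <= X + _](eq_bigl (fun j => j \in inside)); last first.
    by move=> j; rewrite !inE; case: eqVneq => [->|_]; case: eqVneq => [->|_].
  rewrite ler_wpDr ?sumr_ge0//; apply: ler_sum => j; rewrite !inE => /and3P[_ _ ->].
  by case: (x j).
pose d i := (nbad (U :\ k) i x != nbad (U :\ l) i x)%:R : R.
pose v i : R := (1 + nmiss i)^-1.
apply: (@le_trans _ _ (\sum_(i < N) kappa / N%:R
    * (3 * ((~~ a i k)%:R * v i + (~~ a i l)%:R * v i)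
       + ((x k == false)%:R * (1 + e)^-1 + (x l == false)%:R * (1 + e)^-1)))).
  apply: ler_sum => i _; rewrite -/(d i).
  have b0 := base_ge0 i x; have n0 := nmiss_ge0 i.
  have -> : d i * (kappa / (N%:R * (1 + base i x)))
      = kappa / N%:R * (d i / (1 + base i x)).
    by rewrite invfM; ring.
  rewrite ler_wpM2l ?kappaN0//.
  set w := (1 + base i x)^-1.
  have w0 : 0 <= w by rewrite invr_ge0 addr_ge0.
  (* [1 + nmiss i <= 3 + base i x <= 3 (1 + base i x)]. *)
  have wv : w <= 3 * v i.
    rewrite /w /v -[leLHS]mul1r ler_pdivrMr ?ltr_pwDl// mulrAC.
    by rewrite ler_pdivlMr ?ltr_pwDl// mul1r; have := nmiss_le_base i x; lra.
  have we : w <= (1 + e)^-1 by exact: inv1_le.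
  apply: le_trans (ler_wpM2r w0 (nbad_diff i x)) _.
  rewrite [leLHS]mulrDl lerD//.
    by rewrite -!mulrDl mulrCA ler_wpM2l.
  by rewrite -mulrDl ler_wpM2l.
rewrite -mulr_sumr big_split/= -mulr_sumr big_split/= -/(v _).
rewrite sumr_const card_ord -[X in _ + X]mulr_natl.
rewrite mulrDr le_eqVlt; apply/orP; left; apply/eqP; congr (_ + _).
  by rewrite [LHS]mulrA [_ * 3]mulrC [3 * (_ / _)]mulrA.
by rewrite mulrA divfK ?(lt0r_neq0 N0').
Qed.


Let delta : R := lambda - mu.

Let delta0 : 0 <= delta. Proof. by rewrite subr_ge0. Qed.

Let nbad_bounds S i x : (forall j, j != k -> j != l -> (j \in S) = (j \in U)) ->
  base i x <= nbad S i x <= base i x + 2.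
Proof.
move=> SU; rewrite (nbad_split _ _ SU).
by have := bool01 (bad S i k x); have := bool01 (bad S i l x); lra.
Qed.

Let cN0 : 0 <= (1 - lambda) / N%:R.
Proof. by rewrite divr_ge0 ?(ltW c0). Qed.

Let fail_ge i x : delta + (1 - lambda) / N%:R * base i x <= 1 - geo_rate x i.
Proof.
have /andP[h1 _] := nbad_bounds i x memDk; have /andP[h2 _] := nbad_bounds i x memDl.
apply: (subr_geo_ge mu0 (rate_bounds _ _ _) (rate_bounds _ _ _)).
- by rewrite addr_ge0// mulr_ge0.
- by rewrite subr_rate// lerD2l ler_wpM2l.
- by rewrite subr_rate// lerD2l ler_wpM2l.
Qed.

Let fail_le i x :
  1 - geo_rate x i <= (N%:R * delta + mism x + nmiss i + 2) / (N%:R * mu).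
Proof.
have /andP[_ h1] := nbad_bounds i x memDk; have /andP[_ h2] := nbad_bounds i x memDl.
apply: (@le_trans _ _ ((delta + (1 - lambda) / N%:R * (base i x + 2)) / mu)).
  apply: (subr_geo_le mu0 (rate_bounds _ _ _) (rate_bounds _ _ _));
    by rewrite subr_rate// lerD2l ler_wpM2l.
rewrite invfM mulrA ler_wpM2r ?invr_ge0 ?(ltW mu0)//.
rewrite ler_pdivlMr// mulrDl mulrAC divfK ?(lt0r_neq0 N0')//.
rewrite mulrC -!addrA lerD2l.
have := base_le_mism i x; have := base_ge0 i x => b0 bm.
apply: (@le_trans _ _ (base i x + 2)); last by lra.
by rewrite ler_piMl// addr_ge0.
Qed.

(** The proportions of missing links, summed over the points of [U]: up to constants, their
    contribution to the expected number of failures inside [U] after one step. *)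
Let rho : R := (\sum_(j in U) nmiss j) / N%:R.

Let rho0 : 0 <= rho.
Proof. by rewrite divr_ge0// sumr_ge0// => j _; exact: nmiss_ge0. Qed.

Let rho_inside : rho - 2 <= (\sum_(j in inside) nmiss j) / N%:R.
Proof.
rewrite lerBlDr /rho ler_pdivrMr// mulrDl divfK ?(lt0r_neq0 N0')//.
rewrite (bigD1 k)//= (bigD1 l)/=; last by rewrite lU eq_sym.
rewrite (eq_bigl (fun j => j \in inside)); last first.
  by move=> j; rewrite !inE; case: (j \in U); case: (j == k); case: (j == l).
by have := nmiss_le k; have := nmiss_le l; lra.
Qed.

(** A lower bound, by [fail_sum], for one plus the expected number of failures inside [U] after one
    step from [x]. *)
Let tlow x : R := (1 - lambda) / 24 * (1 + N%:R * delta + mism x + rho).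

Let tlow_gt0 x : 0 < tlow x.
Proof.
rewrite mulr_gt0 ?divr_gt0//.
have := mulr_ge0 (ltW N0') delta0; have := mism_ge0 x; have := rho0.
move: (N%:R * delta) => n; lra.
Qed.

Let fail_sum x : N%:R / 6 <= #|inside|%:R :> R ->
  tlow x <= 1 + \sum_(j in inside) (1 - geo_rate x j).
Proof.
move=> Nin.
have inN : #|inside|%:R <= N%:R :> R by rewrite ler_nat -[leqRHS]card_ord max_card.
set A := \sum_(j in inside) _.
have A0 : 0 <= A.
  by apply: sumr_ge0 => j _; rewrite subr_ge0; case/andP: (geo_rate_is_rate x j).
set r := (\sum_(j in inside) nmiss j) / N%:R.
(* [base] is at least the average of its two lower bounds [mism x] and [nmiss j - 2]. *)
have : (\sum_(j in inside) (delta + (1 - lambda) / N%:R * ((mism x + nmiss j) / 2 - 1))) <= A.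
  apply: ler_sum => j _; apply: le_trans (fail_ge j x); rewrite lerD2l ler_wpM2l//.
  by have := mism_le_base j x; have := nmiss_le_base j x; lra.
rewrite big_split/= sumr_const -[X in X + _]mulr_natl -mulr_sumr.
rewrite sumrB sumr_const -mulr_suml big_split/= sumr_const -[mism x *+ _]mulr_natl.
have -> : (1 - lambda) / N%:R * ((#|inside|%:R * mism x + \sum_(j in inside) nmiss j) / 2 - 1 *+ #|inside|)
  = (1 - lambda) * (#|inside|%:R / N%:R * mism x / 2 + r / 2 - #|inside|%:R / N%:R).
  by rewrite /r; field; rewrite (lt0r_neq0 N0').
set p := #|inside|%:R / N%:R.
have p6 : 1 / 6 <= p by rewrite ler_pdivlMr// mulrAC mul1r.
have p1 : p <= 1 by rewrite ler_pdivrMr// mul1r.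
have pm : 1 / 6 * mism x <= p * mism x by rewrite ler_wpM2r.
have nd : N%:R / 6 * delta <= #|inside|%:R * delta by rewrite ler_wpM2r.
have r2 := rho_inside; rewrite -/r in r2.
have r0 : 0 <= r.
  by rewrite divr_ge0 ?(ltW N0')// sumr_ge0// => j _; exact: nmiss_ge0.
have h1 : (1 - lambda) * (mism x / 12 + (rho - 2) / 12 - 1)
    <= (1 - lambda) * (p * mism x / 2 + r / 2 - p).
  by rewrite ler_wpM2l ?(ltW c0)//; lra.
have nd0 : 0 <= N%:R * delta by rewrite mulr_ge0// ltW.
have h2 : (1 - lambda) * (N%:R * delta) <= N%:R * delta by rewrite ler_piMl.
(* Half of this bound on [A] suffices, [A] being nonnegative: the coefficient [1 / 12] becomes
   [1 / 24], and the negative constant [- 7 / 12 * (1 - lambda)] is absorbed by the [1]. *)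
move: h1 h2 nd c1; rewrite /tlow; move: (1 - lambda) (_ * (_ / 2 + r / 2 - p)).
move=> c z; rewrite mulrAC => h1 h2 nd c1' zA; move: A0 nd0.
move: (N%:R * delta) h2 nd => n h2 nd A0 nd0; lra.
Qed.

(* Given [x], the failure of [m] is independent of the count of failures inside
   [U], and its probability exceeds the average one only through [nmiss m]. *)
Let fail_mass m x : m \in U -> N%:R / 6 <= #|inside|%:R :> R -> m \notin inside ->
  \sum_y geo_kern x y * ((y m == false)%:R
      * (1 + \sum_(j in inside) (y j == false)%:R)^-1)
    <= 48 / ((1 - lambda) * mu * N%:R) * (2 + nmiss m / (1 + rho)).
Proof.
move=> mU Nin mi.
rewrite (bern_indep (geo_rate x) false (j := m)); last first.
  move=> y; congr (_^-1); congr (_ + _); apply: eq_bigr => j ji.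
  by rewrite ffunE; case: (eqVneq j m) => // jm; rewrite -jm ji in mi.
have E2 := bern_inv_count_le (b := fun=> false) (geo_rate_is_rate x) (tlow_gt0 x) (fail_sum x Nin).
have z0 : 0 <= 1 - geo_rate x m.
  by rewrite subr_ge0; case/andP: (geo_rate_is_rate x m).
apply: (le_trans (ler_wpM2l z0 E2)).
have t0 := tlow_gt0 x.
apply: (@le_trans _ _ ((N%:R * delta + mism x + nmiss m + 2) / (N%:R * mu) * (2 / tlow x))).
  by rewrite ler_wpM2r ?divr_ge0 ?(ltW t0)// fail_le.
set Y := 1 + N%:R * delta + mism x + rho.
have Y0 : 0 < Y by have := t0; rewrite /tlow pmulr_rgt0// divr_gt0.
(* [48 = 2 * 24], from the [2] of [bern_inv_count_le] and the [24] of [tlow]. *)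
have -> : (N%:R * delta + mism x + nmiss m + 2) / (N%:R * mu) * (2 / tlow x)
    = 48 / ((1 - lambda) * mu * N%:R) * ((N%:R * delta + mism x + nmiss m + 2) / Y).
  rewrite /tlow -/Y; field.
  by rewrite (lt0r_neq0 Y0) (lt0r_neq0 c0) (lt0r_neq0 mu0) (lt0r_neq0 N0').
rewrite ler_wpM2l ?divr_ge0 ?mulr_ge0 ?(ltW c0) ?(ltW mu0) ?(ltW N0')//.
have nd0 : 0 <= N%:R * delta by rewrite mulr_ge0// ltW.
have m0 := mism_ge0 x; have r0 := rho0; have nm0 := nmiss_ge0 m.
have rY : 1 + rho <= Y by rewrite /Y; move: nd0; move: (N%:R * delta) => n; lra.
have r1 : 0 < 1 + rho by rewrite ltr_pwDl.
(* All of the numerator except [nmiss m] is at most [2 Y]; under [nmiss m], [Y] is replaced by the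
   smaller [1 + rho], which is free of [x]. *)
have -> : N%:R * delta + mism x + nmiss m + 2 = nmiss m + (N%:R * delta + mism x + 2).
  by ring.
rewrite mulrDl addrC lerD//.
  rewrite ler_pdivrMr// /Y; move: nd0; move: (N%:R * delta) => n; lra.
by rewrite ler_wpM2l// lef_pV2.
Qed.

(** A starting state of small loss: all sites outside [U] enter the count of [loss_outside], and the
    terms of [loss_inside] with [x k] or [x l] down vanish. *)
Definition up : state := [ffun=> true].

Let sum_geo_kern x (f : state -> R) (p q : R) (u v : state -> R) :
  (forall y, f y <= p + q * (u y + v y)) ->
  \sum_y geo_kern x y * f y
    <= p + q * (\sum_y geo_kern x y * u y + \sum_y geo_kern x y * v y).
Proof.
move=> fuv; have [g0 g1] := geo_kern_stochastic x.
apply: (@le_trans _ _ (\sum_y geo_kern x y * (p + q * (u y + v y)))).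
  by apply: ler_sum => y _; rewrite ler_wpM2l.
rewrite -[X in X + _]mul1r -g1 -big_split/= !mulr_suml mulr_sumr -big_split/=.
by apply: ler_sum => y _; rewrite le_eqVlt; apply/orP; left; apply/eqP; ring.
Qed.

(** Each site outside [U] is up with probability at least [mu], so [bern_inv_count] applies with
    [s = mu * #|~: U|]. *)
Let loss_mean_outside : N%:R / 6 <= #|~: U|%:R :> R ->
  loss up <= 6 * kappa / (mu * N%:R)
  /\ forall x, \sum_y geo_kern x y * loss y <= 6 * kappa / (mu * N%:R).
Proof.
move=> NU.
have U0 : 0 < #|~: U|%:R :> R by apply: lt_le_trans NU; rewrite divr_gt0.
have inv6 : #|~: U|%:R^-1 <= 6 / N%:R :> R.
  by rewrite -[leLHS]mul1r ler_pdivrMr// mulrAC ler_pdivlMr// mul1r; move: NU; lra.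
split.
  apply: le_trans (loss_outside _) _.
  rewrite (eq_bigr (fun=> 1)) ?sumr_const; last by move=> j _; rewrite ffunE.
  have -> : 6 * kappa / (mu * N%:R) = kappa * (6 / N%:R / mu).
    by rewrite invfM; ring.
  rewrite ler_wpM2l ?(ltW kappa0)//.
  apply: (@le_trans _ _ (6 / N%:R)); last first.
    rewrite ler_pdivlMr// ler_piMr ?divr_ge0//.
    by have := mule; have := c0; lra.
  by apply: le_trans inv6; rewrite lef_pV2 ?posrE ?ltr_pwDl// lerDr.
move=> x; apply: (@le_trans _ _ (kappa * (mu * #|~: U|%:R)^-1)); last first.
  rewrite invfM.
  have -> : 6 * kappa / (mu * N%:R) = kappa * (mu^-1 * (6 / N%:R)).
    by rewrite invfM; ring.
  by rewrite !ler_wpM2l ?invr_ge0 ?(ltW mu0) ?(ltW kappa0).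
apply: (@le_trans _ _ (kappa * \sum_y geo_kern x y
    * (1 + \sum_(j in ~: U) (y j == true)%:R)^-1)).
  rewrite mulr_sumr; apply: ler_sum => y _; rewrite mulrCA ler_wpM2l//.
  by case: (geo_kern_stochastic x).
rewrite ler_wpM2l ?(ltW kappa0)//.
apply: (bern_inv_count (b := fun=> true) (geo_rate_is_rate x)).
  by rewrite mulr_gt0.
rewrite [leLHS]mulr_natr -sumr_const; apply: ler_sum => j _.
exact: geo_rate_ge.
Qed.

(** The cost of a pair is written as [f k + f l], one term per point, in view of the average over
    the pairs. *)
Let loss_mean_inside (f : 'I_N -> R) : N%:R / 6 <= #|inside|%:R :> R ->
  (forall m, f m = 3 * kappa / N%:R * (\sum_i (~~ a i m)%:R / (1 + nmiss i))
     + kappa * (48 / ((1 - lambda) * mu * N%:R) * (2 + nmiss m / (1 + rho)))) ->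
  loss up <= f k + f l
  /\ forall x, \sum_y geo_kern x y * loss y <= f k + f l.
Proof.
move=> Nin fE.
have pos m : 0 <= kappa * (48 / ((1 - lambda) * mu * N%:R) * (2 + nmiss m / (1 + rho))).
  rewrite mulr_ge0 ?(ltW kappa0)// mulr_ge0// ?divr_ge0 ?mulr_ge0 ?(ltW c0) ?(ltW mu0)//.
  by rewrite addr_ge0// divr_ge0 ?nmiss_ge0// addr_ge0.
split.
  apply: le_trans (loss_inside _) _; rewrite !ffunE /= !mul0r addr0 mulr0 addr0.
  by rewrite !fE addrACA -mulrDr lerDl addr_ge0.
move=> x; apply: le_trans (sum_geo_kern _ loss_inside) _.
rewrite !fE addrACA -mulrDr lerD2l -mulrDr ler_wpM2l ?(ltW kappa0)//.
by rewrite lerD// fail_mass// !inE eqxx ?andbF.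
Qed.

Let affinity_lower (p : R) n :
  loss up <= p -> (forall x, \sum_y geo_kern x y * loss y <= p) ->
  expR (- (n.+1%:R * p))
    <= Epath (affinity_kernel (kern (U :\ k)) (kern (U :\ l))) n.+1 (fun=> 1) up.
Proof.
move=> lp Mp.
apply: le_trans (Epath_exp_lower n up geo_kern_stochastic affinity_kernel_ge Mp).
by rewrite ler_expR lerN2 -natr1 mulrDl mul1r [leRHS]addrC lerD2r.
Qed.

Local Notation affinity n :=
  (Epath (affinity_kernel (kern (U :\ k)) (kern (U :\ l))) n.+1 (fun=> 1) up).

Lemma affinity_outside (p : R) n : N%:R / 6 <= #|~: U|%:R :> R ->
  6 * kappa / (mu * N%:R) <= p -> expR (- (n.+1%:R * p)) <= affinity n.
Proof.
move=> NU pk; have [h1 h2] := loss_mean_outside NU.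
by apply: affinity_lower => [|x]; [exact: le_trans pk|exact: le_trans (h2 x) pk].
Qed.

Lemma affinity_inside (f : 'I_N -> R) n : N%:R / 6 <= #|U :\ k :\ l|%:R :> R ->
  (forall m, f m = 3 * kappa / N%:R * (\sum_i (~~ a i m)%:R / (1 + nmiss i))
     + kappa * (48 / ((1 - lambda) * mu * N%:R)
       * (2 + nmiss m / (1 + (\sum_(j in U) nmiss j) / N%:R)))) ->
  expR (- (n.+1%:R * (f k + f l))) <= affinity n.
Proof.
by move=> NU fE; have [h1 h2] := loss_mean_inside NU fE; exact: affinity_lower.
Qed.

End swap.

(** * Averaging the affinity over the pairs of [U] *)

Definition step_cost : R :=
  12 * (3 * (4 / mu ^+ 2) + 144 * (4 / mu ^+ 2) / ((1 - lambda) * mu)).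

Lemma step_cost_gt0 : 0 < step_cost.
Proof.
have k0 : 0 < 4 / mu ^+ 2 by rewrite divr_gt0// exprn_gt0.
by rewrite mulr_gt0// addr_gt0 ?mulr_gt0 ?invr_gt0// mulr_gt0.
Qed.

Let sum_pairs (U : {set 'I_N}) (f : 'I_N -> R) :
  \sum_(k in U) \sum_(l in U :\ k) (f k + f l)
    = 2 * (#|U|%:R - 1) * \sum_(k in U) f k.
Proof.
have D1 k : k \in U -> \sum_(l in U :\ k) (f k + f l)
    = (#|U|%:R - 1) * f k + (\sum_(l in U) f l - f k).
  move=> kU; rewrite big_split/=; congr (_ + _).
    rewrite sumr_const -[LHS]mulr_natl; congr (_ * _).
    by rewrite (cardsD1 k U) kU natrD addrAC subrr add0r.
  by rewrite [\sum_(l in U) f l](big_setD1 k)//= addrAC subrr add0r.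
rewrite (eq_bigr _ D1) big_split/= -mulr_sumr sumrB sumr_const -[_ *+ _]mulr_natl.
by ring.
Qed.

(* Jensen's inequality, via the tangent of [expR] at [- m p]. *)
Let sum_pairs_expR (U : {set 'I_N}) (f : 'I_N -> R) (m p : R) : 0 <= m ->
  \sum_(k in U) f k <= #|U|%:R * p / 2 -> (0 < #|U|)%N ->
  #|U|%:R * (#|U|%:R - 1) * expR (- (m * p))
    <= \sum_(k in U) \sum_(l in U :\ k) expR (- (m * (f k + f l))).
Proof.
move=> m0 fp U0.
apply: (@le_trans _ _ (\sum_(k in U) \sum_(l in U :\ k)
    expR (- (m * p)) * ((1 + m * p) - m * (f k + f l)))); last first.
  apply: ler_sum => k _; apply: ler_sum => l _.
  rewrite [X in _ <= expR X](_ : _ = - (m * p) + (m * p - m * (f k + f l))).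
    2: by ring.
  rewrite expRD ler_wpM2l ?expR_ge0//.
  by apply: le_trans (expR_ge1Dx _); rewrite addrA.
have -> : \sum_(k in U) \sum_(l in U :\ k)
    expR (- (m * p)) * (1 + m * p - m * (f k + f l))
  = expR (- (m * p)) * ((1 + m * p) * (#|U|%:R * (#|U|%:R - 1))
      - m * (2 * (#|U|%:R - 1) * \sum_(k in U) f k)).
  rewrite -sum_pairs.
  under eq_bigr do rewrite -mulr_sumr sumrB -mulr_sumr.
  rewrite -mulr_sumr sumrB -mulr_sumr; congr (_ * (_ - _)).
  rewrite (eq_bigr (fun=> (1 + m * p) * (#|U|%:R - 1))); last first.
    move=> k kU; rewrite sumr_const -[LHS]mulr_natr; congr (_ * _).
    by rewrite (cardsD1 k U) kU natrD addrAC subrr add0r.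
  by rewrite sumr_const -[LHS]mulr_natl mulrCA.
rewrite mulrC ler_wpM2l ?expR_ge0//.
have U1 : 0 <= #|U|%:R - 1 :> R by rewrite subr_ge0 ler1n.
have : m * ((#|U|%:R - 1) * (2 * \sum_(k in U) f k)) <= m * ((#|U|%:R - 1) * (#|U|%:R * p)).
  by rewrite !ler_wpM2l//; lra.
move: (#|U|%:R) (\sum_(k in U) f k) => u F; lra.
Qed.

(** If at least [N / 6] points lie outside [U], all pairs share one cost. Otherwise only the total
    of [f] over [U] is controlled, and the bound holds after averaging. *)
Lemma affinity_sum_lower (U : {set 'I_N}) n : (2 <= #|U|)%N -> (3 <= N)%N ->
  #|U|%:R * (#|U|%:R - 1) * expR (- (2 * n.+1%:R * (step_cost / N%:R)))
    <= \sum_(k in U) \sum_(l in U :\ k)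
         (Epath (affinity_kernel (kern (U :\ k)) (kern (U :\ l))) n.+1 (fun=> 1) up) ^+ 2.
Proof.
move=> U2 N3.
have N0 : 0 < N%:R :> R by rewrite ltr0n (leq_trans _ N3).
have N3' : 3 <= N%:R :> R by rewrite ler_nat.
have UN : #|U|%:R <= N%:R :> R by rewrite ler_nat -[leqRHS]card_ord max_card.
set kappa : R := 4 / mu ^+ 2.
have k0 : 0 < kappa by rewrite divr_gt0// exprn_gt0.
have cm0 : 0 < (1 - lambda) * mu by rewrite mulr_gt0.
suff [f fU fW] : exists2 f : 'I_N -> R,
    \sum_(k in U) f k <= #|U|%:R * (step_cost / N%:R) / 2
    & forall k l, k \in U -> l \in U -> k != l ->
      expR (- (n.+1%:R * (f k + f l)))
      <= Epath (affinity_kernel (kern (U :\ k)) (kern (U :\ l))) n.+1 (fun=> 1) up.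
  apply: le_trans (sum_pairs_expR _ fU _) _; rewrite ?mulr_ge0 ?(leq_trans _ U2)//.
  apply: ler_sum => k kU; apply: ler_sum => l; rewrite !inE eq_sym => /andP[kl lU].
  rewrite -[2 * _ * _]mulrA mulr2n mulrDl mul1r opprD expRD -expr2.
  by rewrite ler_sqr ?nnegrE ?expR_ge0 ?(le_trans (expR_ge0 _) (fW k l _ _ _))// fW.
have [out|ins] := leP (N%:R / 6) (#|~: U|%:R : R).
  exists (fun=> step_cost / N%:R / 2).
    by rewrite sumr_const -[leLHS]mulr_natl mulrA.
  move=> k l kU lU kl; apply: affinity_outside => //.
  have -> : 6 * kappa / (mu * N%:R) = 6 * kappa / mu / N%:R.
    by field; rewrite (lt0r_neq0 mu0) (lt0r_neq0 N0).
  rewrite -splitr ler_wpM2r ?invr_ge0 ?(ltW N0)//.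
  rewrite /step_cost -/kappa.
  have h3 : kappa / mu <= kappa / ((1 - lambda) * mu).
    by rewrite ler_wpM2l ?(ltW k0)// lef_pV2 ?posrE// ler_piMl// ltW.
  have h4 : 0 <= kappa / mu by rewrite divr_ge0// ltW.
  move: h3 h4 k0; rewrite -!mulrA; move: (kappa / mu) (kappa / ((1 - lambda) * mu)).
  by move=> u v; lra.
pose rho := (\sum_(j in U) nmiss j) / N%:R.
have rho0 : 0 <= rho by rewrite divr_ge0 ?(ltW N0) ?sumr_ge0// => j _; exact: nmiss_ge0.
pose f m := 3 * kappa / N%:R * (\sum_i (~~ a i m)%:R / (1 + nmiss i))
     + kappa * (48 / ((1 - lambda) * mu * N%:R) * (2 + nmiss m / (1 + rho))).
have cU : #|U|%:R = N%:R - #|~: U|%:R :> R.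
  by have := cardsC U; rewrite card_ord => /(congr1 (fun m => m%:R : R)) <-; rewrite natrD addrK.
exists f.
  have f12 : \sum_(m in U) f m <= step_cost / 12.
    rewrite big_split/= -!mulr_sumr.
    have -> : step_cost / 12 = 3 * kappa / N%:R * N%:R
        + kappa * (48 / ((1 - lambda) * mu * N%:R) * (2 * N%:R + N%:R)).
      rewrite /step_cost -/kappa; field.
      by rewrite (lt0r_neq0 c0) (lt0r_neq0 mu0) (lt0r_neq0 N0).
    have k3 : 0 <= 3 * kappa / N%:R.
      by rewrite mulr_ge0 ?invr_ge0 ?(ltW N0)// mulr_ge0 ?(ltW k0).
    have k48 : 0 <= 48 / ((1 - lambda) * mu * N%:R).
      by rewrite mulr_ge0// invr_ge0 mulr_ge0 ?(ltW cm0) ?(ltW N0).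
    apply: lerD; [rewrite ler_wpM2l//|rewrite ler_wpM2l ?(ltW k0)// ler_wpM2l//].
      (* For each [i], at most [nmiss i] points of [U] have a missing link with [i], so the inner
         sum is at most [nmiss i / (1 + nmiss i) <= 1]. *)
      rewrite exchange_big/=.
      have -> : N%:R = \sum_(j < N) 1 :> R by rewrite sumr_const card_ord.
      apply: ler_sum => i _; rewrite -mulr_suml.
      rewrite ler_pdivrMr ?ltr_pwDl ?nmiss_ge0// mul1r ler_wpDl//.
      rewrite /nmiss [leRHS](bigID (mem U))/= lerDl; exact: sumr_ge0.
    (* The [nmiss m] sum to [N * rho] over [U], so the ratios sum to at most [N]. *)
    rewrite big_split/= sumr_const -[X in X + _]mulr_natl mulrC lerD ?ler_wpM2l//.
    rewrite -mulr_suml ler_pdivrMr ?ltr_pwDl//.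
    rewrite mulrDr mulr1 /rho mulrCA divff ?mulr1 ?(lt0r_neq0 N0)//.
    by rewrite lerDr ltW.
  apply: le_trans f12 _.
  (* The factor [12] of [step_cost] is [6 * 2]: [#|U|] is at least [N / 6], and each point carries
     half the cost of a pair. *)
  have -> : step_cost / 12 = (N%:R / 6) * (step_cost / N%:R) / 2.
    by field; rewrite (lt0r_neq0 N0).
  rewrite ler_wpM2r ?invr_ge0// ler_wpM2r ?divr_ge0 ?(ltW step_cost_gt0) ?(ltW N0)//.
  by rewrite cU; lra.
move=> k l kU lU kl.
have Ukl : #|U :\ k :\ l|%:R = #|U|%:R - 2 :> R.
  rewrite (cardsD1 k U) kU (cardsD1 l (U :\ k)) !inE lU eq_sym kl !natrD /=; lra.
(* [#|U| > 5 N / 6], and [5 N / 6 - 2 >= N / 6] because [N >= 3]. *)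
have ins' : N%:R / 6 <= #|U :\ k :\ l|%:R :> R by rewrite Ukl cU; lra.
exact: affinity_inside.
Qed.

End Kernel.

(** * The law of the observed path given [theta] *)

Section FiniteValued.
Context {d : measure_display} {Omega : measurableType d} {R : realType}.
Context (P : probability Omega R).

Definition pr (A : set Omega) : R := fine (P A).

Lemma pr_ge0 A : 0 <= pr A. Proof. exact: fine_ge0. Qed.

Lemma prE A : measurable A -> P A = (pr A)%:E.
Proof. by move=> mA; rewrite fineK// fin_num_measure. Qed.

Lemma measurable_fiber (I : finType) (Y : I -> {mfun Omega >-> bool}) (y : I -> bool) :
  measurable [set w | forall i, Y i w = y i].
Proof.
rewrite (_ : mkset _ = \bigcap_(i in [set: I]) (Y i @^-1` [set y i])); last first.
  by apply/seteqP; split => w /= h i => [_|]; exact: h.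
by apply: fin_bigcap_measurable => // i _; exact: measurable_funPTI.
Qed.

Lemma fiber_decomposition (V : finType) (Y : Omega -> V) (A : set Omega) :
  A = \bigcup_(v in [set: V]) (A `&` [set w | Y w = v]).
Proof.
by apply/seteqP; split => w /= => [Aw|[v _ []]//]; exists (Y w).
Qed.

Lemma measurable_split (V : finType) (Y : Omega -> V) (A : set Omega) :
  (forall v, measurable (A `&` [set w | Y w = v])) -> measurable A.
Proof.
by move=> mA; rewrite (fiber_decomposition Y A); apply: fin_bigcup_measurable.
Qed.

Lemma pr_split (V : finType) (Y : Omega -> V) (A : set Omega) :
  (forall v, measurable (A `&` [set w | Y w = v])) ->
  pr A = \sum_v pr (A `&` [set w | Y w = v]).
Proof.
move=> mA; apply: EFin_inj; rewrite -prE; last exact: measurable_split mA.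
rewrite {1}(fiber_decomposition Y A) measure_fin_bigcup//.
- rewrite (fsbigE (index_enum V)) ?index_enum_uniq//.
  rewrite -sumEFin; apply: eq_big => [v|v _]; first by rewrite in_setT.
    exact: prE.
  by move=> v _; rewrite mem_index_enum.
- exact: finite_finset.
- by move=> u v _ _ [w [[_ /= <-] [_ /= <-]]].
Qed.

End FiniteValued.

Section Path.
Context {d : measure_display} {Omega : measurableType d} {R : realType} {N : nat}.
Context (X : int -> 'I_N -> {mfun Omega >-> bool}).
Local Notation state := {ffun 'I_N -> bool}.

Definition snapshot (t : int) (w : Omega) : state := [ffun i => X t i w].

Fixpoint path_from (t : int) (n : nat) (w : Omega) : seq state :=
  if n is n'.+1 then snapshot t w :: path_from (t + 1) n' w else [::].

Lemma snapshotE t y : [set w | snapshot t w = y] = X_is X t y.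
Proof.
apply/seteqP; split => w /= h; first by move=> i; rewrite -h ffunE.
by apply/ffunP => i; rewrite ffunE.
Qed.

Lemma measurable_snapshot t y : measurable [set w | snapshot t w = y].
Proof. by rewrite snapshotE; exact: measurable_fiber. Qed.

Lemma drop_path_from m n t w :
  drop m (path_from t (m + n) w) = path_from (t + m%:Z) n w.
Proof.
elim: m t => [|m IHm] t; first by rewrite addr0 drop0.
by rewrite addSn /= IHm -addrA -PoszD.
Qed.

Lemma measurable_path_from n t (F : set (seq state)) :
  measurable [set w | F (path_from t n w)].
Proof.
elim: n t F => [|n IHn] t F /=.
  by case: (pselect (F [::])) => h; [rewrite (_ : mkset _ = setT)|
    rewrite (_ : mkset _ = set0)] => //; apply/seteqP; split.
apply: (measurable_split (Y := snapshot t)) => y.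
rewrite (_ : _ `&` _ = [set w | F (y :: path_from (t + 1) n w)]
    `&` [set w | snapshot t w = y]).
  by apply: measurableI; [exact: (IHn _ (fun s => F (y :: s)))|
    exact: measurable_snapshot].
by apply/seteqP; split => w /= [h e]; split => //; move: h; rewrite e.
Qed.

Lemma path_from_inj n t w w' : path_from t n w = path_from t n w' ->
  forall k i, (k < n)%N -> X (t + k%:Z) i w = X (t + k%:Z) i w'.
Proof.
elim: n t => [//|n IHn] t /= [h1 h2] [|k] i kn.
  by rewrite addr0; move/ffunP: h1 => /(_ i); rewrite !ffunE.
by have := IHn _ h2 k i kn; rewrite intS addrA.
Qed.

(** The sets saturated for equality of paths form a sigma-algebra containing the generators; the
    [T.+1] states read from time [1] are [X_1, ..., X_{T+1}]. *)
Lemma sigma_obs_path T (A : set Omega) : sigma_obs X T A ->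
  exists F : seq state -> bool, A = [set w | F (path_from 1 T.+1 w)].
Proof.
move=> sA; pose path := path_from 1 T.+1.
have sat : forall w w', path w = path w' -> A w -> A w'.
  apply: (smallest_sub (C := sigma_algebra [set: Omega])
    (X := [set A | forall w w', path w = path w' -> A w -> A w'])) sA.
    split => [//|B hB w w' ww' [_ Bw]|B hB w w' ww' [n _ Bw]].
      by split=> // /(hB _ _ (esym ww')).
    by exists n => //; exact: hB ww' Bw.
  move=> _ [t [i [B [tT ->]]]] w w' ww' /=.
  have := path_from_inj ww' (k := t.-1) i.
  case: t tT => [//|t] /= tT /(_ tT).
  by rewrite -intS => ->.
exists (fun s => `[< exists2 w, A w & path w = s >]).
apply/seteqP; split => w /= => [Aw|/asboolP[w' Aw' ww']]; last exact: sat ww' Aw'.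
by apply/asboolP; exists w.
Qed.

Section Conditional.
Context (P : probability Omega R) (mu lambda p : R) (S : {set 'I_N})
  (theta : 'I_N -> 'I_N -> {mfun Omega >-> bool}) (a : 'I_N -> 'I_N -> bool).
Hypothesis model : is_model P mu lambda p S theta X.
Local Notation K := (kern mu lambda a S).

Let measurable_theta_is : measurable (theta_is theta a).
Proof.
rewrite (_ : theta_is _ _ = [set w | forall ij : 'I_N * 'I_N,
    theta ij.1 ij.2 w = a ij.1 ij.2]).
  exact: (measurable_fiber (fun ij : 'I_N * 'I_N => theta ij.1 ij.2)
    (fun ij => a ij.1 ij.2)).
by apply/seteqP; split => w /= h => [[i j]|i j]; [exact: h|exact: (h (i, j))].
Qed.

Lemma pr_theta_is :
  pr P (theta_is theta a) = \prod_(ij : 'I_N * 'I_N) bernoulli_pmf p (a ij.1 ij.2).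
Proof.
case: model => /(_ [set: _]%SET (fun ij => a ij.1 ij.2)) h _ _.
have -> : theta_is theta a = [set w | forall i : 'I_N * 'I_N,
    i \in [set: 'I_N * 'I_N]%SET -> theta i.1 i.2 w = a i.1 i.2].
  apply/seteqP; split => w /= H; first by move=> [i j] _; exact: H.
  by move=> i j; exact: (H (i, j) (finset.in_setT _)).
by rewrite /pr h; apply: eq_bigl => ij; rewrite inE.
Qed.

Let past (t : int) (n : nat) (x : nat -> state) : set Omega :=
  theta_is theta a `&`
    [set w | forall k : nat, (k <= n)%N -> X_is X (t - 1 - k%:Z) (x k) w].

Let measurable_past t n x : measurable (past t n x).
Proof.
apply: measurableI => //.
rewrite (_ : mkset _ = \bigcap_(k in [set k | (k <= n)%N]) X_is X (t - 1 - k%:Z) (x k)).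
  by apply: bigcap_measurableType => k _; exact: measurable_fiber.
by apply/seteqP; split => w /= h k; exact: h.
Qed.

Let past_cons t n x y :
  past t n x `&` [set w | snapshot t w = y]
    = past (t + 1) n.+1 (fun k => if k is k'.+1 then x k' else y).
Proof.
rewrite snapshotE /past -setIA; congr (_ `&` _).
apply/seteqP; split => w /= => [[h hy] [|k] kn|h].
- by rewrite addrK subr0.
- by rewrite (_ : t + 1 - 1 - k.+1%:Z = t - 1 - k%:Z) ?intS; [exact: h|ring].
split => [k kn|].
  by have := h k.+1 kn; rewrite (_ : t + 1 - 1 - k.+1%:Z = t - 1 - k%:Z) ?intS//; ring.
by have := h 0%N isT; rewrite addrK subr0.
Qed.

Let pr_past_cons t n x y :
  pr P (past t n x `&` [set w | snapshot t w = y]) = pr P (past t n x) * K (x 0%N) y.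
Proof.
(* The Markov property is given for pasts of positive probability; on a null past both sides
   vanish. *)
have [past0|past_gt0] := leP (P (past t n x)) 0%E.
  have P0 : P (past t n x) = 0%E by apply/eqP; rewrite eq_le past0 measure_ge0.
  have -> : pr P (past t n x) = 0 by rewrite /pr P0.
  rewrite mul0r /pr.
  have -> : P (past t n x `&` [set w | snapshot t w = y]) = 0%E.
    apply/eqP; rewrite eq_le measure_ge0 andbT -P0.
    by rewrite le_measure ?inE//; apply: measurableI => //; exact: measurable_snapshot.
  by [].
have th0 : (0 < P (theta_is theta a))%E.
  by apply: lt_le_trans past_gt0 _; rewrite le_measure ?inE//; exact: subIsetl.
case: model => _ /(_ a th0 t n x past_gt0 [set: _]%SET y) h _.
rewrite /kern /bern.
have -> : \prod_i bernoulli_pmf (rate mu lambda a S i (x 0%N)) (y i)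
    = cprob P (past t n x) [set w | snapshot t w = y].
  rewrite -[RHS](_ : cprob P (past t n x) [set w | forall i, i \in [set: 'I_N]%SET
    -> X t i w = y i] = _).
    by rewrite h; apply: eq_bigl => i; rewrite inE.
  rewrite snapshotE; congr (cprob _ _ _); apply/seteqP; split => w /= H i //.
  by apply: H; rewrite inE.
rewrite /cprob setIC mulrCA divff ?mulr1//.
apply/eqP => p0; move: past_gt0; rewrite (prE P (measurable_past t n x)).
by rewrite (p0 : pr P (past t n x) = 0) ltxx.
Qed.

Let pr_past_path t n x m (F : seq state -> bool) :
  pr P (past t n x `&` [set w | F (path_from t m w)])
    = pr P (past t n x) * Epath K m (fun s => (F s)%:R) (x 0%N).
Proof.
elim: m t n x F => [|m IHm] t n x F /=.
  case: (F [::]); last first.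
    by rewrite mulr0 (_ : mkset _ = set0) ?setI0 /pr ?measure0//; apply/seteqP; split.
  by rewrite mulr1 (_ : mkset _ = setT) ?setIT//; apply/seteqP; split.
have splitE y : past t n x `&` [set w | F (snapshot t w :: path_from (t + 1) m w)]
    `&` [set w | snapshot t w = y]
  = past (t + 1) n.+1 (fun k => if k is k'.+1 then x k' else y)
    `&` [set w | F (y :: path_from (t + 1) m w)].
  rewrite -past_cons; apply/seteqP; split => w /= [[h1 h2] h3].
    by split; [split|rewrite -h3].
  by split; [split=> //; rewrite h2|].
rewrite (pr_split P (Y := snapshot t)); last first.
  move=> y; rewrite splitE; apply: measurableI; first exact: measurable_past.
  exact: (measurable_path_from m (t + 1) (fun s => F (y :: s))).
rewrite mulr_sumr; apply: eq_bigr => y _.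
by rewrite splitE (IHm _ _ _ (fun s => F (y :: s))) -past_cons pr_past_cons mulrA.
Qed.

(** The state just before [t] is a past of length one, from which the chain is run. *)
Lemma pr_theta_path t m (F : seq state -> bool) :
  pr P (theta_is theta a `&` [set w | F (path_from t m w)])
    = \sum_y pr P (theta_is theta a `&` [set w | snapshot (t - 1) w = y])
        * Epath K m (fun s => (F s)%:R) y.
Proof.
have past0 y : theta_is theta a `&` [set w | snapshot (t - 1) w = y]
    = past t 0 (fun=> y).
  rewrite snapshotE; congr (_ `&` _); apply/seteqP; split => w /= h.
    by case=> // _; rewrite subr0.
  by have := h 0%N isT; rewrite subr0.
have mF : measurable [set w | F (path_from t m w)].
  exact: (measurable_path_from m t (fun s => F s)).
rewrite (pr_split P (Y := snapshot (t - 1))); last first.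
  by move=> y; apply: measurableI; [exact: measurableI|exact: measurable_snapshot].
by apply: eq_bigr => y _; rewrite setIAC past0 pr_past_path.
Qed.

End Conditional.

End Path.

(** * Averaging over the communities *)

Section Averaging.
Context {N : nat}.
Implicit Types (S U : {set 'I_N}).

(* [(S, k) |-> k |: S] is a bijection onto the pointed sets [(U, k)], [k \in U]. *)
Lemma sum_pointed {R : nmodType} (n : nat) (G : {set 'I_N} -> 'I_N -> R) :
  \sum_(U : {set 'I_N} | #|U| == n.+1) \sum_(k in U) G (U :\ k) k
    = \sum_(S : {set 'I_N} | #|S| == n) \sum_(k in ~: S) G S k.
Proof.
rewrite !pair_big_dep/=.
rewrite (reindex_onto (fun q : {set 'I_N} * 'I_N => (q.2 |: q.1, q.2))
  (fun q => (q.1 :\ q.2, q.2)))/=; last first.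
  by move=> [U k] /= /andP[_ kU]; rewrite finset.setD1K.
apply: eq_big => [[S k]|[S k]] /=; last first.
  by move=> /andP[_ /eqP[->]].
rewrite !inE eqxx /= andbT xpair_eqE eqxx andbT.
have [kS|kS] := boolP (k \in S).
  rewrite andbF; apply/negbTE; rewrite negb_and; apply/orP; right.
  by apply/eqP => /finset.setP/(_ k); rewrite !inE eqxx kS.
by rewrite finset.setU1K// eqxx cardsU1 kS add1n eqSS.
Qed.

(** Double counting over the triples [(U, k, l)]: a set [S] of size [n] meets each [l] in [S] in
    [N - n] ways as [U :\ k], and each [l] outside [S] in [n] ways as [U :\ l]. Both multiplicities
    are at most their maximum, and [n (N - n)] is the maximum times the minimum. *)
Lemma averaged_swaps {R : realFieldType} (n : nat) (e : {set 'I_N} -> 'I_N -> R)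
    (beta M : R) :
  (0 < n < N)%N -> (forall S l, 0 <= e S l) ->
  (forall U, #|U| = n.+1 -> #|U|%:R * (#|U|%:R - 1) * beta
     <= \sum_(k in U) \sum_(l in U :\ k) (e (U :\ k) l + e (U :\ l) l)) ->
  (forall S, #|S| = n -> \sum_l e S l <= M) ->
  Num.min n%:R (N%:R - n%:R) * beta <= M.
Proof.
move=> /andP[n0 nN] e0 eU eS.
set s : R := \sum_(S : {set 'I_N} | #|S| == n) 1.
have s0 : 0 < s.
  have [S Sn] : exists S : {set 'I_N}, #|S| == n.
    have /finset.set0Pn[S] : [set S : {set 'I_N} | #|S| == n]%SET != finset.set0.
      by rewrite -card_gt0 card_draws card_ord bin_gt0 ltnW.
    by rewrite inE => h; exists S.
  by rewrite /s (bigD1 S)//= ltr_pwDl// sumr_ge0.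
have cC S : #|S| == n -> #|~: S|%:R = N%:R - n%:R :> R.
  move=> /eqP Sn; have := cardsC S; rewrite card_ord Sn.
  by move=> /(congr1 (fun m => m%:R : R)) <-; rewrite natrD addrAC subrr add0r.
have sU : \sum_(U : {set 'I_N} | #|U| == n.+1) (n.+1%:R : R) = s * (N%:R - n%:R).
  transitivity (\sum_(U : {set 'I_N} | #|U| == n.+1) \sum_(k in U) (1 : R)).
    by apply: eq_bigr => U /eqP Un; rewrite sumr_const Un.
  rewrite (sum_pointed n (fun _ _ => 1)) mulr_suml; apply: eq_bigr => S Sn.
  by rewrite sumr_const -[LHS]mulr_natl mulr1 mul1r cC.
have n1 : n.+1%:R - 1 = n%:R :> R by rewrite -natr1 addrK.
have T1 : \sum_(U : {set 'I_N} | #|U| == n.+1) \sum_(k in U) \sum_(l in U :\ k) e (U :\ k) l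
    = \sum_(S : {set 'I_N} | #|S| == n) (N%:R - n%:R) * \sum_(l in S) e S l.
  rewrite (sum_pointed n (fun S _ => \sum_(l in S) e S l)).
  by apply: eq_bigr => S Sn; rewrite sumr_const -[LHS]mulr_natl cC.
have T2 : \sum_(U : {set 'I_N} | #|U| == n.+1) \sum_(k in U) \sum_(l in U :\ k) e (U :\ l) l
    = \sum_(S : {set 'I_N} | #|S| == n) n%:R * \sum_(l in ~: S) e S l.
  transitivity (\sum_(U : {set 'I_N} | #|U| == n.+1) \sum_(l in U) \sum_(k in U :\ l) e (U :\ l) l).
    apply: eq_bigr => U _; rewrite (exchange_big_dep (mem U))/=; last first.
      by move=> k l _; rewrite !inE => /andP[].
    apply: eq_bigr => l lU; apply: eq_bigl => k; rewrite !inE lU andbT eq_sym.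
    by rewrite andbC.
  rewrite (sum_pointed n (fun S l => \sum_(k in S) e S l)).
  apply: eq_bigr => S /eqP Sn; rewrite mulr_sumr; apply: eq_bigr => l _.
  by rewrite sumr_const Sn -[LHS]mulr_natl.
set b := Num.max n%:R (N%:R - n%:R) : R.
have nb : n%:R <= b by rewrite le_max lexx.
have Nnb : N%:R - n%:R <= b by rewrite le_max lexx orbT.
have n0' : 0 < n%:R :> R by rewrite ltr0n.
have Nn0 : 0 < N%:R - n%:R :> R by rewrite subr_gt0 ltr_nat.
have total : s * (N%:R - n%:R) * (n%:R * beta) <= b * (s * M).
  rewrite -sU mulr_suml.
  apply: (@le_trans _ _ (\sum_(U : {set 'I_N} | #|U| == n.+1) \sum_(k in U)
      \sum_(l in U :\ k) (e (U :\ k) l + e (U :\ l) l))).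
    apply: ler_sum => U /eqP Un; apply: le_trans (eU U Un).
    by rewrite Un n1 mulrA.
  under eq_bigr do under eq_bigr do rewrite big_split/=.
  under eq_bigr do rewrite big_split/=.
  rewrite big_split/= T1 T2 -big_split/= /s mulr_suml mulr_sumr.
  apply: ler_sum => S /eqP Sn; rewrite mul1r.
  apply: (@le_trans _ _ (b * \sum_l e S l)); last first.
    by rewrite ler_wpM2l ?eS// (le_trans (ltW n0')).
  rewrite [in leRHS](bigID (mem S))/= mulrDr lerD//.
    by rewrite ler_wpM2r// sumr_ge0.
  rewrite (eq_bigl (fun l => l \notin S)); last by move=> l; rewrite inE.
  by rewrite ler_wpM2r// sumr_ge0.
have b0 : 0 < b by apply: lt_le_trans nb.
have nNb : n%:R * (N%:R - n%:R) = b * Num.min n%:R (N%:R - n%:R) :> R.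
  by rewrite /b; case: (leP n%:R (N%:R - n%:R : R)) => _ //; rewrite mulrC.
suff : s * b * (Num.min n%:R (N%:R - n%:R) * beta) <= s * b * M.
  by rewrite ler_pM2l ?mulr_gt0.
rewrite mulrA -[s * b * _]mulrA -nNb.
by move: total; rewrite !mulrA [b * s]mulrC [s * n%:R * _]mulrAC.
Qed.

End Averaging.

(** * Testing between swapped communities *)

Section Testing.
Context {R : realType} {N : nat} {d : measure_display} {Omega : measurableType d}.
Context (mu lambda p : R) (lambda01 : 0 < lambda < 1) (mu_lambda : 0 < mu <= lambda)
  (p01 : 0 < p <= 1).
Context (theta : 'I_N -> 'I_N -> {mfun Omega >-> bool})
  (X : int -> 'I_N -> {mfun Omega >-> bool}).
Local Notation state := {ffun 'I_N -> bool}.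
Local Notation config := {ffun 'I_N * 'I_N -> bool}.
Local Notation law a := (bern (fun=> p) (a : config)).
Local Notation K a S := (kern mu lambda (fun i j => (a : config) (i, j)) S).

Let law_rate : is_rate (fun _ : 'I_N * 'I_N => p).
Proof. by move=> ij; case/andP: p01 => /ltW -> ->. Qed.

(* The state at time [- m] may be replaced by [up], the kernel being a
   contraction for the Hamming distance. *)
Let pr_path_lower (P : probability Omega R) S m n (F : seq state -> bool) :
  is_model P mu lambda p S theta X ->
  \sum_a law a * (Epath (K a S) (m + n) (fun s => (F (drop m s))%:R) (up (N := N))
                   - (1 - lambda) ^+ m * N%:R)
    <= pr P [set w | F (path_from X 1 n w)].
Proof.
move=> model.
have l0 : 0 <= 1 - lambda by case/andP: lambda01 => _ /ltW; rewrite subr_ge0.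
have mF : measurable [set w | F (path_from X 1 n w)].
  exact: (measurable_path_from X n 1 (fun s => F s)).
pose Y w : config := [ffun ij => theta ij.1 ij.2 w].
have YE (a : config) : [set w | Y w = a] = theta_is theta (fun i j => a (i, j)).
  apply/seteqP; split => w /= h.
    by move=> i j; rewrite -h ffunE.
  by apply/ffunP => -[i j]; rewrite ffunE; exact: h.
have mY (a : config) : measurable [set w | Y w = a].
  rewrite (_ : mkset _ = [set w | forall ij : 'I_N * 'I_N, theta ij.1 ij.2 w = a ij]).
    exact: (measurable_fiber (fun ij : 'I_N * 'I_N => theta ij.1 ij.2)).
  apply/seteqP; split => w /= h; first by move=> ij; rewrite -h ffunE.
  by apply/ffunP => ij; rewrite ffunE.
rewrite (pr_split P (Y := Y)); last by move=> a; exact: measurableI.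
apply: ler_sum => a _.
have pathE w : path_from X 1 n w = drop m (path_from X (1 - m%:Z) (m + n) w).
  by rewrite drop_path_from subrK.
have -> : [set w | F (path_from X 1 n w)] `&` [set w | Y w = a]
    = theta_is theta (fun i j => a (i, j))
      `&` [set w | F (drop m (path_from X (1 - m%:Z) (m + n) w))].
  by rewrite setIC YE; congr (_ `&` _); apply/seteqP; split => w /=; rewrite pathE.
rewrite (pr_theta_path _ model _ _ (fun s => F (drop m s))).
(* The weight of [a] is split by the state at time [- m], so that the two sides are compared state
   by state. *)
have -> : law a = \sum_y pr P (theta_is theta (fun i j => a (i, j))
    `&` [set w | snapshot X (1 - m%:Z - 1) w = y]).
  rewrite -(pr_split P); last first.
    by move=> y; rewrite -YE; apply: measurableI => //; exact: measurable_snapshot.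
  by rewrite (pr_theta_is _ model); apply: eq_bigr => -[i j] _.
rewrite mulr_suml; apply: ler_sum => y _; rewrite ler_wpM2l ?pr_ge0//.
have phi01 (s : seq state) : 0 <= ((F s)%:R : R) <= 1 by case: (F s); rewrite ?lexx ?ler01.
have := Epath_drop_lipschitz m n (kern_stochastic lambda01 mu_lambda _ S) l0
  (@hamming_ge1 R _) (fun x => sumr_ge0 _ (fun i _ => ler0n _ _))
  (kern_contract lambda01 mu_lambda _ S) phi01 (up (N := N)) y.
move=> /(_ (fun i j => a (i, j))) /ler_normlP[_ h].
rewrite lerBlDr -lerBlDl (le_trans h)// ler_wpM2l ?exprn_ge0//.
by have := hamming_le (R := R) (up (N := N)) y; rewrite card_ord.
Qed.

Context (P : {set 'I_N} -> probability Omega R) (T : nat)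
  (Phat : Omega -> {set 'I_N} * {set 'I_N}) (hatP : is_estimator X T Phat).

Definition err S l : R :=
  pr (P S) [set w | l \in if l \in S then (Phat w).2 else (Phat w).1].

Let err_path (l : 'I_N) : exists F : seq state -> bool,
  [set w | l \in (Phat w).2] = [set w | F (path_from X 1 T.+1 w)]
  /\ [set w | l \in (Phat w).1] = [set w | ~~ F (path_from X 1 T.+1 w)].
Proof.
case: hatP => hatC hatm.
have [F FE] := sigma_obs_path (hatm [set v : {set 'I_N} * {set 'I_N} | l \in v.2]).
exists F; split; first exact: FE.
apply/seteqP; split => w /=.
  move=> lw; apply/negP => Fw.
  have : (Phat @^-1` [set v : {set 'I_N} * {set 'I_N} | l \in v.2]) w by rewrite FE.
  by rewrite /= hatC inE lw.
move=> /negP nF; apply: contraPT isT => lw _; apply: nF.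
suff : (Phat @^-1` [set v : {set 'I_N} * {set 'I_N} | l \in v.2]) w by rewrite FE.
by rewrite /= hatC inE.
Qed.

Lemma expectation_MR S : ('E_(P S)[fun w => MR (S, ~: S) (Phat w)]
  = (N%:R^-1 * \sum_l err S l)%:E)%E.
Proof.
pose A l := [set w | l \in if l \in S then (Phat w).2 else (Phat w).1].
have mA l : measurable (A l).
  rewrite /A; have [F [E2 E1]] := err_path l.
  case: (l \in S); rewrite ?E2 ?E1.
    exact: (measurable_path_from X T.+1 1 (fun s => F s)).
  exact: (measurable_path_from X T.+1 1 (fun s => ~~ F s)).
have mE w : MR (S, ~: S) (Phat w) = N%:R^-1 * \sum_l \1_(A l) w :> R.
  rewrite /MR; congr (_ * _).
  have -> : \sum_l \1_(A l) w
      = \sum_l (l \in if l \in S then (Phat w).2 else (Phat w).1)%:R :> R.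
    apply: eq_bigr => l _; rewrite indicE; congr (nat_of_bool _)%:R.
    by apply/idP/idP => [/set_mem|/mem_set].
  rewrite -natr_sum; congr (_%:R).
  rewrite -!sum1_card [X in (X + _)%N]big_mkcond [X in (_ + X)%N]big_mkcond/=.
  rewrite -big_split/=; apply: eq_bigr => l _.
  rewrite !inE; case: (l \in S); rewrite ?andbF ?andbT /=; by case: (_ \in _).
rewrite unlock.
transitivity (\int[P S]_w (\sum_(l <- index_enum 'I_N) ((N%:R^-1)%:E * (\1_(A l) w)%:E)))%E.
  apply: eq_integral => w _.
  by rewrite mE mulr_sumr -sumEFin.
rewrite ge0_integral_sum//; last first.
  by move=> l; apply: measurable_funeM; apply/measurable_EFinP; exact: measurable_indic.
rewrite mulr_sumr -sumEFin; apply: eq_bigr => l _.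
rewrite ge0_integralZl_EFin//; last first.
  by apply/measurable_EFinP; exact: measurable_indic.
by rewrite integral_indic// setIT EFinM; congr (_ * _)%E; exact: prE.
Qed.

Lemma err_ge0 S l : 0 <= err S l. Proof. exact: pr_ge0. Qed.

(** A label of [l] right for one model is wrong for the other, so the two errors are those of a test
    between the models. Replacing the state at time [- m] costs [N (1 - lambda)^m] for each of
    them. *)
Lemma err_swap (U : {set 'I_N}) k l m : k \in U -> l \in U -> k != l ->
  is_model (P (U :\ k)) mu lambda p (U :\ k) theta X ->
  is_model (P (U :\ l)) mu lambda p (U :\ l) theta X ->
  \sum_a law a * ((Epath (affinity_kernel (K a (U :\ k)) (K a (U :\ l)))
      (m + T).+1 (fun=> 1) (up (N := N))) ^+ 2 / 2
     - 2 * N%:R * (1 - lambda) ^+ m)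
  <= err (U :\ k) l + err (U :\ l) l.
Proof.
move=> kU lU kl mk ml; have [F [E2 E1]] := err_path l.
have lk : l \in U :\ k by rewrite !inE eq_sym kl.
have ll : (l \in U :\ l) = false by rewrite !inE eqxx.
rewrite /err lk ll E2 E1.
apply: le_trans (lerD (pr_path_lower m T.+1 F mk)
  (pr_path_lower m T.+1 (fun s => ~~ F s) ml)).
rewrite -big_split; apply: ler_sum => a _; rewrite -[leRHS]mulrDr ler_wpM2l ?bern_ge0//.
have phi01 (s : seq state) : 0 <= ((F (drop m s))%:R : R) <= 1.
  by case: (F _); rewrite ?lexx ?ler01.
have := Epath_test (m + T.+1) (up (N := N))
  (kern_stochastic lambda01 mu_lambda (fun i j => a (i, j)) (U :\ k))
  (kern_stochastic lambda01 mu_lambda (fun i j => a (i, j)) (U :\ l)) phi01.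
have -> : (fun s => 1 - (F (drop m s))%:R) = (fun s => (~~ F (drop m s))%:R) :> (seq state -> R).
  by apply/funext => s; case: (F _); rewrite /= ?subrr ?subr0.
rewrite addnS; set u := Epath _ _ _ _; set v := Epath _ _ _ _; set w := Epath _ _ _ _.
by move: (_ ^+ m) => r; move: (N%:R) => c; lra.
Qed.

(** The average over [theta] is taken last: for fixed [a], the affinities are bounded below only
    after summation over the pairs. *)
Lemma err_pairs (U : {set 'I_N}) m : (2 <= #|U|)%N -> (3 <= N)%N ->
  (forall k, k \in U -> is_model (P (U :\ k)) mu lambda p (U :\ k) theta X) ->
  #|U|%:R * (#|U|%:R - 1)
    * (expR (- (2 * (m + T).+1%:R * (step_cost mu lambda / N%:R))) / 2
       - 2 * N%:R * (1 - lambda) ^+ m)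
  <= \sum_(k in U) \sum_(l in U :\ k) (err (U :\ k) l + err (U :\ l) l).
Proof.
move=> U2 N3 model.
set r := 2 * N%:R * (1 - lambda) ^+ m.
pose W a k l := Epath (affinity_kernel (K a (U :\ k)) (K a (U :\ l)))
  (m + T).+1 (fun=> 1) (up (N := N)).
set E := expR _.
have swapW k l : k \in U -> l \in U -> k != l ->
    \sum_a law a * (W a k l ^+ 2 / 2 - r) <= err (U :\ k) l + err (U :\ l) l.
  by move=> kU lU kl; exact: (err_swap m kU lU kl (model k kU) (model l lU)).
have affW a : #|U|%:R * (#|U|%:R - 1) * E
    <= \sum_(k in U) \sum_(l in U :\ k) W a k l ^+ 2.
  exact: affinity_sum_lower.
move: W r E swapW affW => W r E swapW affW.
apply: (@le_trans _ _ (\sum_(k in U) \sum_(l in U :\ k)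
    \sum_a law a * (W a k l ^+ 2 / 2 - r))); last first.
  apply: ler_sum => k kU; apply: ler_sum => l; rewrite !inE eq_sym => /andP[kl lU].
  exact: swapW.
under eq_bigr do rewrite exchange_big/=.
rewrite exchange_big/= -[leLHS]mul1r.
rewrite -[X in X * _](sum_bern (fun _ : 'I_N * 'I_N => p)) mulr_suml.
apply: ler_sum => a _.
under eq_bigr do rewrite -mulr_sumr.
rewrite -mulr_sumr ler_wpM2l ?bern_ge0//.
have -> : \sum_(k in U) \sum_(l in U :\ k) (W a k l ^+ 2 / 2 - r)
    = (\sum_(k in U) \sum_(l in U :\ k) W a k l ^+ 2) / 2 - #|U|%:R * (#|U|%:R - 1) * r.
  under eq_bigr do rewrite sumrB -mulr_suml.
  rewrite sumrB -mulr_suml; congr (_ - _).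
  rewrite (eq_bigr (fun=> (#|U|%:R - 1) * r)); last first.
    move=> k kU; rewrite sumr_const -[LHS]mulr_natl; congr (_ * _).
    by rewrite [in RHS](cardsD1 k U) kU natrD addrAC subrr add0r.
  by rewrite sumr_const -[LHS]mulr_natl mulrA.
have := affW a; set Q := \sum_(k in U) _; move: (#|U|%:R * _) => c.
lra.
Qed.

End Testing.

(* [m] steps of mixing are paid for by the second term of the bracket: they cost
   [C m / n] in the exponent, with [m] of order [ln (2 n)], and [tau_K(u)] is at
   least of order [K u] where [tau_K(u) < 1/2]. *)
Lemma half_bracket_le {R : realType} (C L n t m r : R) :
  0 < C -> 0 < L -> 2 <= n -> 1 <= t -> 0 <= m ->
  m <= 2 * ln (2 * n) / L + 1 -> r <= (2 * n)^-1 ^+ 2 ->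
  let K2 := 4 / 3 * (2 * C / L + (C + 2^-1) / ln 2) in
  let bracket := 1 - tau (4 * C) (t / n) - 2 * tau K2 (ln (2 * n) / n) in
  0 < bracket ->
  bracket / 2 <= expR (- (2 * (m + t + 1) * (C / n))) / 2 - 2 * n * r.
Proof.
move=> C0 L0 n2 t1 m0 mL rn K2 bracket bracket0.
have n0 : 0 < n by lra.
have ln2 : 0 < ln 2 :> R by rewrite ln_gt0// ltr1n.
have l0 : 0 < ln (2 * n) by rewrite ln_gt0//; lra.
have ln2n : ln 2 <= ln (2 * n) by rewrite ler_ln ?posrE; lra.
set l := ln (2 * n) in mL K2 bracket bracket0 l0 ln2n *.
pose v := K2 * (l / n).
have K20 : 0 < K2.
  by rewrite mulr_gt0// addr_gt0// divr_gt0// ?mulr_gt0// addr_gt0.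
have v0 : 0 < v by rewrite mulr_gt0// divr_gt0.
set tau1 := tau _ _ in bracket bracket0 *; set tau2 := tau _ _ in bracket bracket0 *.
have tau10 : 0 <= tau1 by exact: sqrtr_ge0.
have tau20 : 0 <= tau2 by exact: sqrtr_ge0.
have sub1_expR (u : R) : 0 <= u -> 0 <= 1 - expR (- u).
  by move=> u0; rewrite subr_ge0 -expR0 ler_expR oppr_le0.
have tau2E : tau2 ^+ 2 = 1 - expR (- v) by rewrite sqr_sqrtr// sub1_expR// ltW.
have tau2h : tau2 < 1 / 2 by move: bracket0; rewrite /bracket; lra.
(* As [tau2 < 1 / 2], [expR (- v) >= 3 / 4]; then [tau2 >= tau2 ^+ 2 = 1 - expR (- v) >= v * expR (-
   v)]. *)
have tau2v : 3 / 4 * v <= tau2.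
  have sq : tau2 ^+ 2 < 1 / 4.
    have : 0 <= tau2 * (1 / 2 - tau2) by apply: mulr_ge0; lra.
    by move: tau2h; lra.
  have ev : 3 / 4 <= expR (- v) by move: sq; rewrite tau2E; lra.
  have ve : v * expR (- v) <= 1 - expR (- v).
    have := expR_ge1Dx v; rewrite -(ler_pM2r (expR_gt0 (- v))) -expRD subrr expR0.
    by lra.
  have : v * (3 / 4) <= v * expR (- v) by rewrite ler_wpM2l// ltW.
  have : tau2 ^+ 2 <= tau2 by rewrite expr2 ler_piMl//; lra.
  by move: ve; rewrite -tau2E; lra.
set E := expR (- (4 * C * (t / n))).
have E1 : E <= 1.
  by rewrite -expR0 ler_expR oppr_le0 mulr_ge0 ?divr_ge0//; lra.
have tau1E : 1 - tau1 <= E.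
  have sE : tau1 ^+ 2 = 1 - E.
    by rewrite sqr_sqrtr// sub1_expR// mulr_ge0 ?divr_ge0//; lra.
  have t1le : tau1 <= 1.
    by rewrite -[leRHS]sqrtr1 ler_wsqrtr// gerBl expR_ge0.
  have : tau1 ^+ 2 <= tau1 by rewrite expr2 ler_piMl.
  by move: sE; lra.
have E0 : 0 < E := expR_gt0 _.
(* [t >= 1] gives [2 (t + 1) <= 4 t], whence the constant [4 C]; the factor due to the [m] mixing
   steps is linearised. *)
have lowE : E - 2 * m * (C / n) <= expR (- (2 * (m + t + 1) * (C / n))).
  apply: (@le_trans _ _ (E * expR (- (2 * m * (C / n))))).
    have Cn : 0 <= 2 * m * (C / n) by rewrite mulr_ge0 ?divr_ge0//; lra.
    have := expR_ge1Dx (- (2 * m * (C / n))); rewrite -(ler_pM2l E0).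
    have : E * (2 * m * (C / n)) <= 2 * m * (C / n) by rewrite ler_piMl.
    by move: (2 * m * (C / n)) => z; lra.
  rewrite /E -expRD ler_expR.
  have : 0 <= (t - 1) * (C / n) by rewrite mulr_ge0 ?divr_ge0//; lra.
  have -> : 4 * C * (t / n) = 4 * t * (C / n) by ring.
  by move: (C / n) => z; lra.
have nr : 2 * n * r <= 1 / 2 / n.
  apply: (@le_trans _ _ (2 * n * (2 * n)^-1 ^+ 2)); first by rewrite ler_wpM2l//; lra.
  by rewrite expr2 mulrA divff ?mul1r ?invfM// mulf_neq0// gt_eqF.
(* [l / ln 2 >= 1] turns the constants [C] and [1 / 2], due to the rounding of [m] and to [r], into
   multiples of [l]; [K2] is chosen so that the resulting bound is [3 / 4 * v]. *)
have cost : m * (C / n) + 1 / 2 / n <= 3 / 4 * v.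
  have -> : 3 / 4 * v = ((2 * l / L) * C + l / ln 2 * (C + 1 / 2)) / n.
    by rewrite /v /K2; field; rewrite !gt_eqF.
  have -> : m * (C / n) + 1 / 2 / n = (m * C + 1 / 2) / n by ring.
  rewrite ler_wpM2r ?invr_ge0 ?(ltW n0)//.
  have h1 : 1 <= l / ln 2 by rewrite ler_pdivlMr// mul1r.
  have h2 : m * C <= (2 * l / L + 1) * C by rewrite ler_wpM2r// ltW.
  have h3 : 1 * (C + 1 / 2) <= l / ln 2 * (C + 1 / 2) by rewrite ler_wpM2r//; lra.
  by move: h2 h3; move: (2 * l / L) (l / ln 2) => y z; lra.
rewrite /bracket; move: lowE; rewrite -[2 * m * _]mulrA.
move: (expR (- (2 * (m + t + 1) * (C / n)))) cost nr => Y; lra.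
Qed.

(** * The minimax lower bound *)

Theorem theorem2p12 (R : realType) (lambda mu : R)
  (hlambda : 0 < lambda < 1) (hmu : 0 < mu <= lambda) :
  exists K1 K2 : R, [/\ 0 < K1, 0 < K2 &
    forall (p rplus rminus : R) (N T : nat)
      (d : measure_display) (Omega : measurableType d)
      (theta : 'I_N -> 'I_N -> {mfun Omega >-> bool})
      (X : int -> 'I_N -> {mfun Omega >-> bool})
      (P : {set 'I_N} -> probability Omega R),
    0 < p <= 1 ->
    0 < rplus < 1 -> 0 < rminus < 1 -> rplus + rminus = 1 ->
    (2 <= N)%N -> (1 <= T)%N ->
    (forall S : {set 'I_N}, calS rplus S ->
       is_model (P S) mu lambda p S theta X) ->
    let rmin := Num.min rplus rminus in
    let bracket := 1 - tau K1 (T%:R / N%:R)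
                     - 2 * tau K2 (ln (2 * N%:R) / N%:R) in
    (* Excludes only the case where both factors of the bound are negative.
       There it can fail: for N = 2, rplus = 9/10 the only S is the whole of
       [N] and the risk is 0, but the bound is positive for T large. *)
    0 <= rmin - N%:R^-1 \/ 0 <= bracket ->
    (((rmin - N%:R^-1) / 2 * bracket)%:E
      <= ereal_inf [set max_risk P rplus Phat
                   | Phat in [set Phat | is_estimator X T Phat]])%E].
Proof.
have [l0 l1] := andP hlambda; have [m0 ml] := andP hmu.
set C := step_cost mu lambda.
have C0 : 0 < C by exact: step_cost_gt0.
pose L := - ln (1 - lambda).
have L0 : 0 < L by rewrite oppr_gt0 ln_lt0//; lra.
have ln2 : 0 < ln 2 :> R by rewrite ln_gt0// ltr1n.
(* The constants of [half_bracket_le], with [C] the cost of one step in the affinity and [L] the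
   exponential rate of mixing. *)
exists (4 * C), (4 / 3 * (2 * C / L + (C + 2^-1) / ln 2)); split.
- by rewrite mulr_gt0.
- rewrite mulr_gt0// addr_gt0//; first by apply: divr_gt0 => //; exact: mulr_gt0.
  by apply: divr_gt0 => //; apply: addr_gt0.
move=> p rplus rminus N T d Omega theta X P p01 rp01 rm01 rpm N2 T1 model rmin bracket sgn.
have [rp0 rp1] := andP rp01; have [rm0 rm1] := andP rm01.
have N0 : 0 < N%:R :> R by rewrite ltr0n (leq_trans _ N2).
have N2' : 2 <= N%:R :> R by rewrite ler_nat.
apply: le_ereal_inf_tmp => _ [Phat hatP <-].
set c := Num.ceil (N%:R * rplus).
have c0 : 0 <= c.
  by rewrite ceil_ge0; have := mulr_gt0 N0 rp0; lra.
pose n := `|c|%N.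
have nE : n%:Z = c by rewrite gez0_abs.
have nR : n%:R = c%:~R :> R by rewrite -nE.
have calSE (S : {set 'I_N}) : calS rplus S = (#|S| == n) by rewrite -eqz_nat nE.
have n_ge : N%:R * rplus <= n%:R by rewrite nR ceil_ge.
have n_lt : n%:R < N%:R * rplus + 1.
  by have /andP[+ _] := ceil_itv (N%:R * rplus); rewrite nR intrB -/c ltrBlDr.
have nN : (n <= N)%N.
  rewrite -(ler_nat R) nR -[N%:R]/(N%:Z%:~R) ler_int ceil_le_int.
  by rewrite ler_piMr// ltW.
have [S0 S0n] : exists S : {set 'I_N}, #|S| == n.
  have /finset.set0Pn[S] : [set S : {set 'I_N} | #|S| == n]%SET != finset.set0.
    by rewrite -card_gt0 card_draws card_ord bin_gt0.
  by rewrite inE => h; exists S.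
have risk_ge (S : {set 'I_N}) : #|S| == n ->
    ('E_(P S)[fun w => MR (S, ~: S) (Phat w)] <= max_risk P rplus Phat)%E.
  move=> Sn; apply: (le_bigmax_cond _ (fun S : {set 'I_N} => 'E_(P S)[fun w => MR (S, ~: S) (Phat w)])%E).
  by rewrite calSE.
(* A nonpositive bound holds because the risk is nonnegative; otherwise [sgn] makes both factors
   positive. *)
have [bad|good] := leP ((rmin - N%:R^-1) / 2 * bracket) 0.
  apply: (@le_trans _ _ 0%E); first by rewrite lee_fin.
  apply: le_trans (risk_ge S0 S0n); apply: expectation_ge0 => w.
  by rewrite /MR mulr_ge0 ?invr_ge0.
have [rmin0 bracket0] : 0 < rmin - N%:R^-1 /\ 0 < bracket.
  case: sgn => [h|h].
    have h' : 0 < rmin - N%:R^-1.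
      by rewrite lt_neqAle h andbT; apply/eqP => e; move: good; rewrite -e !mul0r ltxx.
    by split => //; move: good; rewrite pmulr_rgt0// divr_gt0.
  have h' : 0 < bracket.
    by rewrite lt_neqAle h andbT; apply/eqP => e; move: good; rewrite -e mulr0 ltxx.
  by split => //; move: good; rewrite pmulr_lgt0// pmulr_lgt0// invr_gt0.
have Nmin : 0 < N%:R * rmin - 1.
  have : 0 < N%:R * (rmin - N%:R^-1) by rewrite mulr_gt0.
  by rewrite mulrBr divff// gt_eqF.
have rmin_p : N%:R * rmin <= N%:R * rplus by rewrite ler_wpM2l ?(ltW N0)// ge_min lexx.
have rmin_m : N%:R * rmin <= N%:R * rminus.
  by rewrite ler_wpM2l ?(ltW N0)// ge_min lexx orbT.
have Nsplit : N%:R * rplus + N%:R * rminus = N%:R by rewrite -mulrDr rpm mulr1.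
(* Rounding [N * rplus] up to [n] takes less than [1] from [N - n]. *)
have min_ge : N%:R * rmin - 1 <= Num.min n%:R (N%:R - n%:R).
  by rewrite le_min; apply/andP; split; lra.
have n0 : (0 < n)%N by rewrite -(ltr_nat R); lra.
have nltN : (n < N)%N by rewrite -(ltr_nat R); lra.
(* [N * rplus] and [N * rminus] both exceed [1] and sum to [N]. *)
have N3 : (3 <= N)%N by rewrite -(ltr_nat R); lra.
have ln2N : 0 < ln (2 * N%:R) :> R by rewrite ln_gt0//; lra.
have x0 : 0 <= 2 * ln (2 * N%:R) / L by rewrite divr_ge0 ?(ltW L0)// mulr_ge0// ltW.
(* [m] is rounded up so that [(1 - lambda)^m <= (2 N)^-2]. *)
have [m m_le m_ge] : exists2 m : nat,
    m%:R <= 2 * ln (2 * N%:R) / L + 1 & 2 * ln (2 * N%:R) <= m%:R * L.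
  exists (Num.truncn (2 * ln (2 * N%:R) / L)).+1.
    by rewrite -natr1 lerD2r truncn_le.
  by rewrite -ler_pdivrMr// ltW// truncnS_gt.
have decay : (1 - lambda) ^+ m <= (2 * N%:R)^-1 ^+ 2.
  rewrite -[1 - lambda](@lnK R) ?posrE; last by lra.
  rewrite -expRM_natl -[(2 * N%:R)^-1](@lnK R) ?posrE ?invr_gt0; last by lra.
  rewrite -expRM_natl ler_expR lnV ?posrE; last by lra.
  by move: m_ge; rewrite /L; lra.
set beta := expR (- (2 * (m + T).+1%:R * (C / N%:R))) / 2 - 2 * N%:R * (1 - lambda) ^+ m.
have beta_ge : bracket / 2 <= beta.
  have mT : (m + T).+1%:R = m%:R + T%:R + 1 :> R by rewrite -natr1 natrD.
  rewrite /beta mT.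
  by apply: (half_bracket_le C0 L0) => //; rewrite ler1n.
(* The worst set [S1] bounds all total errors at once, as [averaged_swaps] requires. *)
have [S1 S1n S1max] := @arg_maxP _ _ _ _ (fun S : {set 'I_N} => #|S| == n)
  (fun S => \sum_l err P Phat S l) S0n.
apply: le_trans (risk_ge S1 S1n).
rewrite (expectation_MR P hatP) lee_fin.
have : Num.min n%:R (N%:R - n%:R) * beta <= \sum_l err P Phat S1 l.
  apply: (@averaged_swaps _ _ _ (err P Phat)); first by rewrite n0 nltN.
  - by move=> S l; exact: err_ge0.
  - move=> U Un; apply: (err_pairs hlambda hmu p01 hatP) => //.
      by rewrite Un ltnS.
    move=> k kU; apply: model; rewrite calSE.
    by move: Un; rewrite (cardsD1 k) kU add1n => -[->].
  - by move=> S /eqP Sn; exact: S1max.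
move=> h; rewrite -(ler_pM2l N0) [leRHS]mulrA divff ?mul1r ?gt_eqF//.
apply: le_trans h; apply: (@le_trans _ _ ((N%:R * rmin - 1) * beta)).
  have -> : N%:R * ((rmin - N%:R^-1) / 2 * bracket) = (N%:R * rmin - 1) * (bracket / 2).
    by field; rewrite gt_eqF.
  by rewrite ler_wpM2l// ltW.
by rewrite ler_wpM2r// (le_trans _ beta_ge)// divr_ge0// ltW.
Qed.
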